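(* There are universal constants $c_1, c_2 > 0$ such that for all finite sets $C$ and $E$, every $n \in \mathbb{N}$, every $\mathcal{D} \subseteq C^n$ and every function $f : \mathcal{D} \rightarrow E$, $$Q(f) \geq c_1 \, \mathrm{Adv}^{\pm}(f) \qquad \text{and} \qquad Q(f) \leq c_2 \, \mathrm{Adv}^{\pm}(f) \, \log |C| \cdot \log |E| ,$$ where $Q(f)$ is the bounded-error quantum query complexity of $f$ and $\mathrm{Adv}^{\pm}(f)$ is the general adversary bound of $f$.
   Context: Notation: $[n] = \{1, \ldots, n\}$; $\|\cdot\|$ is the spectral norm of an operator. General adversary bound: for $f : \mathcal{D} \to E$ with $\mathcal{D} \subseteq C^n$, an adversary matrix for $f$ is a real symmetric $|\mathcal{D}| \times |\mathcal{D}|$ matrix $\Gamma$, with rows and columns indexed by $\mathcal{D}$, such that $\Gamma_{x,y} = 0$ for all $x, y \in \mathcal{D}$ with $f(x) = f(y)$. For $j \in [n]$ let $\Delta_j$ be the $\mathcal{D} \times \mathcal{D}$ matrix whose $(x,y)$ entry is $1$ if $x_j \neq y_j$ and $0$ otherwise, and let $\Gamma \circ \Delta_j$ denote the entry-wise product. Then $$\mathrm{Adv}^{\pm}(f) = \max_{\Gamma} \frac{\|\Gamma\|}{\max_{j \in [n]} \|\Gamma \circ \Delta_j\|},$$ the maximum being over all nonzero adversary matrices $\Gamma$ for $f$ (entries may be negative); if $f$ is constant, so that there is no nonzero adversary matrix, $\mathrm{Adv}^{\pm}(f) = 0$. Quantum query complexity: identify $C$ with $\mathbb{Z}/|C|\mathbb{Z}$.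 On input $x \in \mathcal{D}$ the algorithm has access to the oracle unitary $O_x$ (and its inverse) mapping $|i, b\rangle \mapsto |i, b + x_i\rangle$ for $i \in [n]$, $b \in C$. A $T$-query quantum algorithm starts in a fixed state of a finite-dimensional space (query registers tensored with an arbitrary workspace), applies input-independent unitaries interleaved with $T$ applications of $O_x$ or $O_x^{-1}$ (acting as the identity on the workspace), and then performs an input-independent measurement producing an output in $E$. $Q(f)$ is the least $T$ such that some $T$-query algorithm outputs $f(x)$ with probability at least $2/3$ for every $x \in \mathcal{D}$. *)

(* Defs.v *)
From HB Require Import structures.
From mathcomp Require Import all_boot all_order all_algebra.
From mathcomp Require Import complex.
From mathcomp Require Import all_classical all_reals all_analysis.

Set Implicit Arguments.
Unset Strict Implicit.
Unset Printing Implicit Defensive.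

Import Order.TTheory GRing.Theory Num.Theory.

Local Open Scope ring_scope.
Local Open Scope classical_set_scope.
Local Open Scope complex_scope.
Local Open Scope sesquilinear_scope.

Definition sqnorm (K : numDomainType) (m : nat) (v : 'cV[K]_m) : K :=
  \sum_(i < m) `|v i ord0| ^+ 2.

Definition l2norm (R : realType) (m : nat) (v : 'cV[R]_m) : R :=
  Num.sqrt (sqnorm v).

(* Operator norm for the Euclidean norms. It is used for real symmetric
   matrices only, for which real vectors suffice. *)
Definition specnorm (R : realType) (m : nat) (A : 'M[R]_m) : R :=
  sup [set l2norm (A *m v) | v in [set v : 'cV[R]_m | l2norm v <= 1]].

(* D as a finite type, for D a set of words in C^n. *)
Definition dom (C : finType) (n : nat) (D : {set {ffun 'I_n -> C}}) : finType :=
  {x : {ffun 'I_n -> C} | x \in D}.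

Section Adversary.
Variables (R : realType) (C E : finType) (n : nat).
Variables (D : {set {ffun 'I_n -> C}}) (f : dom D -> E).

(* Rows and columns are indexed by D through enum_val : 'I_#|dom D| -> dom D. *)
Definition adversary_matrix (G : 'M[R]_#|dom D|) : Prop :=
  G^T = G /\
  forall a b : 'I_#|dom D|, f (enum_val a) = f (enum_val b) -> G a b = 0.

Definition Delta (j : 'I_n) : 'M[R]_#|dom D| :=
  \matrix_(a < #|dom D|, b < #|dom D|)
    (val (enum_val a) j != val (enum_val b) j)%:R.

Definition hadamard (m : nat) (A B : 'M[R]_m) : 'M[R]_m := map2_mx *%R A B.

(* For constant f the set is empty and sup set0 = 0. Otherwise the set is
   bounded, and the denominators are positive: a nonzero entry of G sits at a
   pair of words which differ in some position. *)
Definition Adv : R :=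
  sup [set specnorm G / \big[Num.max/0]_(j < n) specnorm (hadamard G (Delta j))
      | G in [set G | adversary_matrix G /\ G != 0]].

End Adversary.

(* Computational basis |i, b, w> of the query registers and a workspace of
   dimension d. *)
Definition qbasis (C : finType) (n d : nat) : finType :=
  ('I_n * C * 'I_d)%type.

(* |i, b, w> |-> |i, b + x_i, w>, acting on column vectors, where c : C is
   identified with (enum_rank c mod #|C|). *)
Definition oracle (R : realType) (C : finType) (n d : nat)
    (x : {ffun 'I_n -> C}) : 'M[R[i]]_#|qbasis C n d| :=
  \matrix_(p < #|qbasis C n d|, q < #|qbasis C n d|)
    (let: (i', b', w') := enum_val p in
     let: (i, b, w) := enum_val q in
     [&& i' == i, w' == w
       & enum_rank b' == enum_rank b + enum_rank (x i) %[mod #|C|]])%:R.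

(* Only the first T queries and the unitaries 0, ..., T are used by a T-query
   run. The measurement is given by Kraus operators: on the state psi, outcome e
   has probability || qmeas e psi ||^2. *)
Record qalg (R : realType) (C E : finType) (n : nat) := QAlg {
  qdim : nat;
  qstart : 'cV[R[i]]_#|qbasis C n qdim|;
  qunit : nat -> 'M[R[i]]_#|qbasis C n qdim|;
  qinv : nat -> bool; (* whether query number t uses the inverse oracle *)
  qmeas : E -> 'M[R[i]]_#|qbasis C n qdim|;
  qstart_norm : sqnorm qstart = 1;
  qunitP : forall t, qunit t \is unitarymx;
  qmeasP : \sum_(e : E) (qmeas e)^t* *m qmeas e = 1%:M
}.

Section Query.
Variables (R : realType) (C E : finType) (n : nat).

Definition query (A : qalg R C E n) (x : {ffun 'I_n -> C}) (t : nat) :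
    'M[R[i]]_#|qbasis C n (qdim A)| :=
  if qinv A t then invmx (oracle R (qdim A) x) else oracle R (qdim A) x.

Fixpoint qstate (A : qalg R C E n) (x : {ffun 'I_n -> C}) (T : nat) :
    'cV[R[i]]_#|qbasis C n (qdim A)| :=
  if T is t.+1 then qunit A t.+1 *m (query A x t *m qstate A x t)
  else qunit A 0 *m qstart A.

Definition qprob (A : qalg R C E n) (x : {ffun 'I_n -> C}) (T : nat) (e : E) :
    R[i] :=
  sqnorm (qmeas A e *m qstate A x T).

Definition computes (D : {set {ffun 'I_n -> C}}) (f : dom D -> E)
    (A : qalg R C E n) (T : nat) : Prop :=
  forall x : dom D, 2 / 3 <= qprob A (val x) T (f x).

(* If n = 0 or C is empty, the query registers have dimension 0 and carry no
   state; if E is empty, there is no measurement with outcomes in E. In these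
   cases D has at most one point, and no query is needed. In all other cases
   the infimum is the least T (+oo if there were none). *)
Definition Q (D : {set {ffun 'I_n -> C}}) (f : dom D -> E) : \bar R :=
  if [|| n == 0%N, #|C| == 0%N | #|E| == 0%N] then 0%E
  else ereal_inf [set (T%:R)%:E | T in
                   [set T : nat | exists A : qalg R C E n, computes f A T]].

End Query.

Arguments Adv R {C E n D} f.
Arguments Q R {C E n D} f.

(* Main.v *)
Require Import Defs.
From mathcomp Require Import all_boot all_order all_algebra.
From mathcomp Require Import complex.
From mathcomp Require Import all_classical all_reals all_analysis.
From mathcomp Require Import ring lra.

Set Implicit Arguments.
Unset Strict Implicit.
Unset Printing Implicit Defensive.

Import Order.TTheory GRing.Theory Num.Theory.

Local Open Scope ring_scope.

(* Lower bound (Hoyer, Lee, Spalek).  For an adversary matrix G and weights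
   delta, the progress sum_{x,y} G_xy delta_x delta_y Re <psi_x, psi_y> over the
   states of the algorithm changes by at most 2 max_j ||G o Delta_j|| |delta|^2
   in one query.  For two output values, success probability 2/3 forces it below
   (17/18) ||G|| |delta|^2 at the end.  Larger E reduces to two values: a random
   h : E -> bool keeps half of G on average, and keeping only the entries
   separated by h does not increase the norms ||G o Delta_j||.

   Upper bound.  By Hahn-Banach duality there are real vectors w_xj, p_xj of
   squared length O(Adv) with
     sum_{j : x_j <> y_j} (<w_xj, w_yj> - <p_xj, p_yj>) = [f x <> f y].
   The algorithm (after Belovs and Yolcu) uses them as catalysts, scaled by
   T^(-1/2).  A direct query to the w part and an inverse query to the p part
   change the Gram matrix of the states by 1/T times this identity, so T rounds
   move the whole weight from a common start state to |f x>.  The true start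
   state lacks the catalysts, an error of norm O(sqrt(Adv / T)) that the
   unitaries preserve. *)

(** * Spectral norms of real matrices and their bilinear forms *)

Section SpectralNorm.
Variable R : realType.
Implicit Types (m : nat).

Definition bilin m (A : 'M[R]_m) (u v : 'I_m -> R) : R :=
  \sum_(i < m) \sum_(j < m) A i j * u i * v j.

Lemma sqnorm_realE m (v : 'cV[R]_m) : sqnorm v = \sum_(i < m) v i ord0 ^+ 2.
Proof. by apply: eq_bigr => i _; rewrite real_normK // num_real. Qed.

Lemma sumsqr_ge0 (I : finType) (P : pred I) (u : I -> R) :
  0 <= \sum_(i | P i) u i ^+ 2.
Proof. by apply: sumr_ge0 => i _; exact: sqr_ge0. Qed.

Lemma sqr_le_sumsqr m (u : 'I_m -> R) i : u i ^+ 2 <= \sum_(k < m) u k ^+ 2.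
Proof. by rewrite (bigD1 i) //= lerDl sumsqr_ge0. Qed.

Lemma sqr_l2norm m (v : 'cV[R]_m) : l2norm v ^+ 2 = sqnorm v.
Proof. by rewrite sqr_sqrtr // sqnorm_realE sumsqr_ge0. Qed.

Lemma l2normZ m (c : R) (v : 'cV[R]_m) : l2norm (c *: v) = `|c| * l2norm v.
Proof.
rewrite /l2norm !sqnorm_realE -sqrtr_sqr -sqrtrM ?sqr_ge0 // mulr_sumr.
by congr Num.sqrt; apply: eq_bigr => i _; rewrite mxE exprMn.
Qed.

Lemma l2norm_eq0 m (v : 'cV[R]_m) : l2norm v = 0 -> v = 0.
Proof.
move=> v0; apply/matrixP => i j; rewrite ord1 mxE; apply/eqP.
rewrite -sqrf_eq0 eq_le sqr_ge0 andbT.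
have := sqr_le_sumsqr (fun k => v k ord0) i.
by rewrite -sqnorm_realE -sqr_l2norm v0 expr0n.
Qed.

(** Boundedness gives the [sup] in [specnorm] its meaning; row sums of absolute values serve as a
    crude bound. *)
Lemma specnorm_ubound m (A : 'M[R]_m) :
  has_ubound [set l2norm (A *m v) | v in [set v : 'cV[R]_m | l2norm v <= 1]]%classic.
Proof.
exists (Num.sqrt (\sum_(i < m) (\sum_(j < m) `|A i j|) ^+ 2)) => _ [v /= v1 <-].
rewrite /l2norm sqnorm_realE ler_wsqrtr //; apply: ler_sum => i _.
rewrite -real_normK ?num_real // lerXn2r ?nnegrE ?normr_ge0 ?sumr_ge0 //.
rewrite mxE (le_trans (ler_norm_sum _ _ _)) //; apply: ler_sum => j _.
rewrite normrM ler_piMr //.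
rewrite -(@ler_pXn2r _ 2%N) ?nnegrE // expr1n real_normK ?num_real //.
rewrite (le_trans (sqr_le_sumsqr (fun k => v k ord0) j)) //.
by rewrite -sqnorm_realE -sqr_l2norm expr_le1 // sqrtr_ge0.
Qed.

Lemma l2norm_mulmx_le m (A : 'M[R]_m) (v : 'cV[R]_m) :
  l2norm (A *m v) <= specnorm A * l2norm v.
Proof.
have [v0|vn0] := eqVneq (l2norm v) 0.
  by rewrite (l2norm_eq0 v0) mulmx0 -(scale0r 0) l2normZ normr0 mul0r mulr0.
have vgt0 : 0 < l2norm v by rewrite lt_def vn0 sqrtr_ge0.
have iv0 : 0 <= (l2norm v)^-1 by rewrite invr_ge0 ltW.
rewrite -ler_pdivrMr // mulrC -[X in X * _](ger0_norm iv0).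
rewrite -l2normZ scalemxAr; apply: (ub_le_sup (specnorm_ubound A)).
exists ((l2norm v)^-1 *: v) => //=.
by rewrite l2normZ ger0_norm // mulVf.
Qed.

Lemma specnorm_ge0 m (A : 'M[R]_m) : 0 <= specnorm A.
Proof.
apply: (ub_le_sup (specnorm_ubound A)).
by exists 0 => /=; rewrite ?mulmx0 -(scale0r 0) l2normZ normr0 mul0r.
Qed.

Lemma bilinE m (A : 'M[R]_m) (u v : 'I_m -> R) :
  bilin A u v = \sum_(i < m) u i * (A *m \col_j v j) i ord0.
Proof.
apply: eq_bigr => i _; rewrite mxE mulr_sumr.
by apply: eq_bigr => j _; rewrite mxE mulrCA mulrA.
Qed.

(** Weighted AM-GM in each coordinate of u and A v, together with |A v| <= ||A|| |v|. The free
    weight [theta] allows vectors of unequal length to be balanced. *)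
Lemma bilin_le m (A : 'M[R]_m) (u v : 'I_m -> R) (theta : R) : 0 < theta ->
  `|bilin A u v| <= specnorm A / 2 *
     (theta * (\sum_(i < m) u i ^+ 2) + theta^-1 * (\sum_(i < m) v i ^+ 2)).
Proof.
move=> t0; rewrite bilinE.
set w := A *m _.
have wle : \sum_i w i ord0 ^+ 2 <= specnorm A ^+ 2 * \sum_(i < m) v i ^+ 2.
  rewrite -sqnorm_realE -sqr_l2norm.
  have -> : \sum_(i < m) v i ^+ 2 = l2norm (\col_j v j) ^+ 2.
    by rewrite sqr_l2norm sqnorm_realE; apply: eq_bigr => i _; rewrite mxE.
  rewrite -exprMn lerXn2r ?nnegrE ?mulr_ge0 ?specnorm_ge0 ?sqrtr_ge0 //.
  exact: l2norm_mulmx_le.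
(* The AM-GM weight ||A|| theta must be invertible, so norm 0 is treated apart. *)
have [s0|sn0] := eqVneq (specnorm A) 0.
  rewrite s0 mul0r mul0r big1 ?normr0 // => i _.
  suff /eqP -> : w i ord0 == 0 by rewrite mulr0.
  rewrite -sqrf_eq0 eq_le sqr_ge0 andbT.
  apply: le_trans (sqr_le_sumsqr (fun k => w k ord0) i) _.
  by rewrite (le_trans wle) // s0 expr0n mul0r.
have s0 : 0 < specnorm A by rewrite lt_def sn0 specnorm_ge0.
pose a := specnorm A * theta; have a0 : 0 < a by rewrite mulr_gt0.
have amgm (x y : R) : `|x * y| <= (a * x ^+ 2 + a^-1 * y ^+ 2) / 2.
  have [b0 b1] : 0 < a^-1 /\ a * a^-1 = 1 by rewrite invr_gt0 divff ?gt_eqF.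
  have h1 : 0 <= a^-1 * (a * x - y) ^+ 2 by rewrite mulr_ge0 ?sqr_ge0 ?ltW.
  have h2 : 0 <= a^-1 * (a * x + y) ^+ 2 by rewrite mulr_ge0 ?sqr_ge0 ?ltW.
  have E1 : a^-1 * (a * x - y) ^+ 2 = a * x ^+ 2 + a^-1 * y ^+ 2 - 2 * x * y.
    by field; rewrite gt_eqF.
  have E2 : a^-1 * (a * x + y) ^+ 2 = a * x ^+ 2 + a^-1 * y ^+ 2 + 2 * x * y.
    by field; rewrite gt_eqF.
  by rewrite ler_norml; apply/andP; split; lra.
apply: le_trans (ler_norm_sum _ _ _) _.
apply: le_trans (ler_sum _ (fun i _ => amgm _ _)) _.
rewrite -mulr_suml big_split /= -!mulr_sumr.
have : a^-1 * \sum_i w i ord0 ^+ 2 <=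
       a^-1 * (specnorm A ^+ 2 * \sum_(i < m) v i ^+ 2).
  by rewrite ler_wpM2l // invr_ge0 ltW.
have -> : a^-1 * (specnorm A ^+ 2 * \sum_(i < m) v i ^+ 2) =
   specnorm A * (theta^-1 * \sum_(i < m) v i ^+ 2).
  by rewrite /a; field; rewrite sn0 gt_eqF.
rewrite /a; lra.
Qed.

Lemma bilin_diag_le m (A : 'M[R]_m) (v : 'I_m -> R) :
  `|bilin A v v| <= specnorm A * \sum_(i < m) v i ^+ 2.
Proof.
apply: le_trans (bilin_le A v v ltr01) _.
by rewrite invr1 mul1r; lra.
Qed.

Lemma bilin_polar m (A : 'M[R]_m) (u v : 'I_m -> R) : A^T = A ->
  4 * bilin A u v = bilin A (fun i => u i + v i) (fun i => u i + v i)
                  - bilin A (fun i => u i - v i) (fun i => u i - v i).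
Proof.
move=> symA.
have swap : bilin A v u = bilin A u v.
  rewrite /bilin exchange_big; apply: eq_bigr => i _; apply: eq_bigr => j _.
  by rewrite -{1}symA mxE; ring.
have -> : 4 * bilin A u v = 2 * bilin A u v + 2 * bilin A v u by rewrite swap; ring.
rewrite /bilin !mulr_sumr -!big_split -!sumrB /=; apply: eq_bigr => i _.
by rewrite !mulr_sumr -!big_split -!sumrB /=; apply: eq_bigr => j _; ring.
Qed.

(** |A v| is the value of the bilinear form at v and the unit vector u = A v / |A v|. By symmetry,
    polarization reduces it to the quadratic form at u + v and u - v, whose squared lengths add up
    to at most 4 by the parallelogram law. *)
Lemma specnorm_le m (A : 'M[R]_m) (c : R) : A^T = A -> 0 <= c ->
  (forall v : 'I_m -> R, `|bilin A v v| <= c * \sum_(i < m) v i ^+ 2) ->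
  specnorm A <= c.
Proof.
move=> symA c0 Ac; apply: ge_sup.
  by exists (l2norm (A *m 0)); exists 0 => //=;
    rewrite -(scale0r 0) l2normZ normr0 mul0r.
move=> _ [v /= v1 <-].
set w := A *m v; have [->//|wn0] := eqVneq (l2norm w) 0.
pose u i := (l2norm w)^-1 * w i ord0; pose v' i := v i ord0.
have u1 : \sum_(i < m) u i ^+ 2 = 1.
  rewrite (eq_bigr (fun i => (l2norm w)^-1 ^+ 2 * w i ord0 ^+ 2)); last first.
    by move=> i _; rewrite exprMn.
  by rewrite -mulr_sumr -sqnorm_realE -sqr_l2norm -exprMn mulVf // expr1n.
have v1' : \sum_(i < m) v' i ^+ 2 <= 1.
  by rewrite -sqnorm_realE -sqr_l2norm expr_le1 // sqrtr_ge0.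
have -> : l2norm w = bilin A u v'.
  have vE : \col_j v' j = v by apply/matrixP=> i j; rewrite mxE ord1.
  rewrite bilinE vE -/w.
  rewrite (eq_bigr (fun i => (l2norm w)^-1 * w i ord0 ^+ 2)); last first.
    by move=> i _; rewrite /u; ring.
  by rewrite -mulr_sumr -sqnorm_realE -sqr_l2norm expr2 mulrA mulVf // mul1r.
have par : (\sum_(i < m) (u i + v' i) ^+ 2) + (\sum_(i < m) (u i - v' i) ^+ 2) =
   2 * (\sum_(i < m) u i ^+ 2) + 2 * (\sum_(i < m) v' i ^+ 2).
  by rewrite !mulr_sumr -!big_split /=; apply: eq_bigr => i _; ring.
have := bilin_polar u v' symA.
have := Ac (fun i => u i + v' i); rewrite ler_norml => /andP[_].
have := Ac (fun i => u i - v' i); rewrite ler_norml => /andP[+ _].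
have := ler_wpM2l c0 v1'; have := congr1 ( *%R c) par; rewrite u1.
set X := bilin _ _ _; set Y := bilin _ _ _; rewrite !mulrDr. lra.
Qed.

Lemma entry_le_specnorm m (A : 'M[R]_m) i j : `|A i j| <= specnorm A.
Proof.
have dsum k (F : 'I_m -> R) : \sum_(l < m) F l * (l == k)%:R = F k.
  rewrite (bigD1 k) //= eqxx mulr1 big1 ?addr0 // => l /negPf ->.
  by rewrite mulr0.
have dsq k : \sum_(l < m) ((l == k)%:R : R) ^+ 2 = 1.
  by rewrite -[RHS](dsum k (fun=> 1)); apply: eq_bigr => l _;
    case: (l == k); rewrite ?mul1r ?expr1n ?expr0n.
have := bilin_le A (fun l => (l == i)%:R) (fun l => (l == j)%:R) ltr01.
rewrite !dsq /bilin (eq_bigr (fun l => A l j * (l == i)%:R)); last first.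
  by move=> l _; rewrite dsum.
by rewrite dsum invr1; lra.
Qed.

End SpectralNorm.

(** * Real inner products of complex state vectors *)

Section ComplexInner.
Variable R : realType.
Local Open Scope complex_scope.
Local Open Scope sesquilinear_scope.

(* The inner product of C = R^2 over the reals. *)
Definition cdot (z w : R[i]) : R :=
  complex.Re z * complex.Re w + complex.Im z * complex.Im w.

(** The real part of the Hermitian inner product. Adversary matrices are real, so a real progress
    function suffices. *)
Definition rip m (u v : 'cV[R[i]]_m) : R := \sum_(k < m) cdot (u k ord0) (v k ord0).

Lemma cdotE (z w : R[i]) : cdot z w = complex.Re (Num.conj z * w).
Proof. by case: z w => [a b] [c d]; rewrite /cdot /=; ring. Qed.

Lemma Re_sum (I : Type) (r : seq I) (P : pred I) (F : I -> R[i]) :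
  complex.Re (\sum_(i <- r | P i) F i) = \sum_(i <- r | P i) complex.Re (F i).
Proof. by apply: (big_morph (@complex.Re R)) => // -[a b] [c d]. Qed.

Lemma ripE m (u v : 'cV[R[i]]_m) : rip u v = complex.Re ((u^t* *m v) ord0 ord0).
Proof. by rewrite mxE Re_sum; apply: eq_bigr => k _; rewrite cdotE !mxE. Qed.

Lemma sqnorm_rip m (u : 'cV[R[i]]_m) : sqnorm u = (rip u u)%:C.
Proof.
rewrite rmorph_sum; apply: eq_bigr => k _.
by rewrite -add_Re2_Im2 /cdot !expr2.
Qed.

Lemma rip_ge0 m (u : 'cV[R[i]]_m) : 0 <= rip u u.
Proof. by apply: sumr_ge0 => k _; rewrite addr_ge0 // -expr2 sqr_ge0. Qed.


Lemma rip_unitary m (U : 'M[R[i]]_m) (u v : 'cV[R[i]]_m) :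
  U \is unitarymx -> rip (U *m u) (U *m v) = rip u v.
Proof.
move=> /unitarymxP /mulmx1C UU; rewrite !ripE trmx_mul map_mxM.
by rewrite -mulmxA [X in _ *m X]mulmxA UU mul1mx.
Qed.

(** Completeness makes u -> (K_e u)_e an isometry. *)
Lemma rip_kraus (E : finType) m (K : E -> 'M[R[i]]_m) (u v : 'cV[R[i]]_m) :
  \sum_(e : E) (K e)^t* *m K e = 1%:M ->
  \sum_(e : E) rip (K e *m u) (K e *m v) = rip u v.
Proof.
move=> K1; rewrite !ripE -[in RHS](mul1mx v) -K1 mulmx_suml mulmx_sumr summxE Re_sum.
apply: eq_bigr => e _; rewrite ripE trmx_mul map_mxM.
by rewrite -!mulmxA.
Qed.

Lemma cdotZ (a b : R) (z w : R[i]) : cdot (a%:C * z) (b%:C * w) = a * b * cdot z w.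
Proof. by case: z w => [c d] [e g]; rewrite /cdot /=; ring. Qed.

Lemma ripZ m (a b : R) (u v : 'cV[R[i]]_m) :
  rip (a%:C *: u) (b%:C *: v) = a * b * rip u v.
Proof. by rewrite /rip mulr_sumr; apply: eq_bigr => k _; rewrite !mxE cdotZ. Qed.

(** Each coordinate k contributes its real and its imaginary part, two instances of [bilin_le] for
    vectors indexed by the inputs. The predicate [P] later selects one query position. *)
Lemma family_bilin_le N (A : 'M[R]_N) (K : finType) (P : pred K)
    (a b : 'I_N -> K -> R[i]) (theta : R) : 0 < theta ->
  `|\sum_(x < N) \sum_(y < N) A x y * \sum_(k | P k) cdot (a x k) (b y k)| <=
  specnorm A / 2 *
    (theta * (\sum_(x < N) \sum_(k | P k) cdot (a x k) (a x k)) +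
     theta^-1 * (\sum_(y < N) \sum_(k | P k) cdot (b y k) (b y k))).
Proof.
move=> t0.
have -> : \sum_(x < N) \sum_(y < N) A x y * \sum_(k | P k) cdot (a x k) (b y k) =
  \sum_(k | P k) (bilin A (fun x => complex.Re (a x k)) (fun y => complex.Re (b y k)) +
                  bilin A (fun x => complex.Im (a x k)) (fun y => complex.Im (b y k))).
  rewrite /bilin.
  under eq_bigr do under eq_bigr do rewrite mulr_sumr.
  under eq_bigr do rewrite exchange_big /=.
  rewrite exchange_big /=; apply: eq_bigr => k _.
  rewrite -big_split /=; apply: eq_bigr => x _.
  rewrite -big_split /=; apply: eq_bigr => y _; rewrite /cdot; ring.
apply: le_trans (ler_norm_sum _ _ _) _.
rewrite [X in _ <= _ * (_ * X + _)]exchange_big /=.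
rewrite [X in _ <= _ * (_ + _ * X)]exchange_big /=.
rewrite [theta * _]mulr_sumr [theta^-1 * _]mulr_sumr -big_split /= mulr_sumr.
apply: ler_sum => k _.
apply: le_trans (ler_normD _ _) _.
apply: le_trans (lerD (bilin_le A _ _ t0) (bilin_le A _ _ t0)) _.
rewrite -mulrDr addrACA -!mulrDr -!big_split /= le_eqVlt.
by apply/orP; left; apply/eqP; congr (_ * (_ * _ + _ * _));
  apply: eq_bigr => x _; rewrite /cdot !expr2.
Qed.

Lemma family_rip_le N (A : 'M[R]_N) m (a b : 'I_N -> 'cV[R[i]]_m) (theta : R) :
  0 < theta ->
  `|\sum_(x < N) \sum_(y < N) A x y * rip (a x) (b y)| <=
  specnorm A / 2 *
    (theta * (\sum_(x < N) rip (a x) (a x)) +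
     theta^-1 * (\sum_(y < N) rip (b y) (b y))).
Proof.
exact: (family_bilin_le A xpredT (fun x k => a x k ord0) (fun y k => b y k ord0)).
Qed.

End ComplexInner.

(** * The oracle as a permutation of the basis *)

Section Oracle.
Variables (R : realType) (C : finType) (n d : nat).
Local Open Scope complex_scope.

Lemma cshift_subproof (c b : C) :
  ((enum_rank b + enum_rank c) %% #|C| < #|C|)%N.
Proof. by rewrite ltn_pmod //; apply/card_gt0P; exists b. Qed.

Definition cshift (c b : C) : C := enum_val (Ordinal (cshift_subproof c b)).

Lemma cshift_inj c : injective (cshift c).
Proof.
move=> b b' /enum_val_inj /(congr1 val) /= /eqP.
rewrite eqn_modDr !modn_small // => /eqP /val_inj; exact: enum_rank_inj.
Qed.

(** The place from which a query reads a coordinate. A permutation of the basis acts on coordinates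
    by its inverse, so the inverse query reads at [cshift] and the direct one at the inverse
    shift. *)
Definition query_shift (inv : bool) (c : C) : C -> C :=
  if inv then cshift c else invF (@cshift_inj c).

Lemma query_shift_bij inv c : bijective (query_shift inv c).
Proof.
rewrite /query_shift; case: inv; first exact: injF_bij (@cshift_inj c).
by exists (cshift c); [exact: f_invF | exact: invF_f].
Qed.

Definition oshift (g : C -> C -> C) (x : {ffun 'I_n -> C}) (s : qbasis C n d) :
  qbasis C n d := (s.1.1, g (x s.1.1) s.1.2, s.2).

Lemma ocshift_inj g x : (forall c, injective (g c)) -> injective (oshift g x).
Proof. by move=> gI [[i b] w] [[i' b'] w'] [-> + ->] => /gI ->. Qed.

Lemma oracleE (x : {ffun 'I_n -> C}) p q :
  oracle R d x p q = (enum_val p == oshift cshift x (enum_val q))%:R.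
Proof.
rewrite mxE /oshift; case: (enum_val p) => [[i' b'] w'].
case: (enum_val q) => [[i b] w] /=; rewrite !xpair_eqE.
have -> : (b' == cshift (x i) b) =
   (enum_rank b' == enum_rank b + enum_rank (x i) %[mod #|C|]).
  rewrite -(inj_eq enum_rank_inj) -val_eqE /= /cshift enum_valK /=.
  by rewrite [in RHS](modn_small (ltn_ord _)).
by case: (i' == i) => //=; rewrite andbC.
Qed.

Lemma oracle_unitary (x : {ffun 'I_n -> C}) : (oracle R d x)^T *m oracle R d x = 1%:M.
Proof.
apply/matrixP => p q; rewrite mxE [RHS]mxE.
rewrite (bigD1 (enum_rank (oshift cshift x (enum_val p)))) //=.
rewrite big1 ?addr0 => [|k kp]; last first.
  rewrite mxE !oracleE; case: eqP => [kE|]; last by rewrite mul0r.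
  by rewrite -kE enum_valK eqxx in kp.
rewrite mxE !oracleE enum_rankK eqxx mul1r.
by rewrite (inj_eq (ocshift_inj cshift_inj)) (inj_eq enum_val_inj).
Qed.

Lemma oracle_mulE (x : {ffun 'I_n -> C}) (v : 'cV[R[i]]_#|qbasis C n d|) s :
  (oracle R d x *m v) (enum_rank (oshift cshift x s)) ord0 = v (enum_rank s) ord0.
Proof.
rewrite mxE (bigD1 (enum_rank s)) //= oracleE !enum_rankK eqxx mul1r.
rewrite big1 ?addr0 // => k ks; rewrite oracleE enum_rankK.
rewrite (inj_eq (ocshift_inj cshift_inj)) -(inj_eq enum_rank_inj) enum_valK.
by rewrite eq_sym (negPf ks) mul0r.
Qed.

Lemma oracle_invE (x : {ffun 'I_n -> C}) (v : 'cV[R[i]]_#|qbasis C n d|) s :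
  (invmx (oracle R d x) *m v) (enum_rank s) ord0 =
  v (enum_rank (oshift cshift x s)) ord0.
Proof.
have [_ Ou] := mulmx1_unit (oracle_unitary x).
by rewrite -[LHS](oracle_mulE x) mulKVmx.
Qed.

End Oracle.

(** * Queries in coordinates, one query position at a time *)

Section Query.
Variables (R : realType) (C E : finType) (n : nat).
Local Open Scope complex_scope.

Lemma queryE (A : qalg R C E n) (x : {ffun 'I_n -> C}) t
    (v : 'cV[R[i]]_#|qbasis C n (qdim A)|) s :
  (query A x t *m v) (enum_rank s) ord0 =
  v (enum_rank (oshift (query_shift (qinv A t)) x s)) ord0.
Proof.
rewrite /query /query_shift; case: (qinv A t); first exact: oracle_invE.
rewrite -(oracle_mulE x); congr ((_ *m _) _ _); congr enum_rank.
by case: s => [[i b] w]; rewrite /oshift /= f_invF.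
Qed.

Definition bip d (i : 'I_n) (u v : 'cV[R[i]]_#|qbasis C n d|) : R :=
  \sum_(s : qbasis C n d | s.1.1 == i)
    cdot (u (enum_rank s) ord0) (v (enum_rank s) ord0).

Lemma rip_bip d (u v : 'cV[R[i]]_#|qbasis C n d|) :
  rip u v = \sum_(i < n) bip i u v.
Proof.
rewrite /rip (reindex (@enum_rank (qbasis C n d))) /=; last first.
  exact: onW_bij (@enum_rank_bij _).
by rewrite (partition_big (fun s : qbasis C n d => s.1.1) predT).
Qed.

(** On the block of position i a query is a shift that depends on the input only through its letter
    at i, hence the same permutation for x and y. *)
Lemma bip_query (A : qalg R C E n) (x y : {ffun 'I_n -> C}) t i
    (u v : 'cV[R[i]]_#|qbasis C n (qdim A)|) :
  x i = y i -> bip i (query A x t *m u) (query A y t *m v) = bip i u v.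
Proof.
move=> xy; rewrite [RHS](reindex (oshift (query_shift (qinv A t)) x)) /=; last first.
  apply/onW_bij/injF_bij/ocshift_inj => c; exact: bij_inj (query_shift_bij _ _).
apply: eq_bigr => s /eqP si; rewrite !queryE /oshift si.
by rewrite xy.
Qed.

Lemma rip_query (A : qalg R C E n) (x : {ffun 'I_n -> C}) t
    (u v : 'cV[R[i]]_#|qbasis C n (qdim A)|) :
  rip (query A x t *m u) (query A x t *m v) = rip u v.
Proof. by rewrite !rip_bip; apply: eq_bigr => i _; rewrite bip_query. Qed.

End Query.

(** * Lower bound by the adversary method *)

Section LowerBound.
Variables (R : realType) (C E : finType) (n : nat) (D : {set {ffun 'I_n -> C}}).
Local Open Scope complex_scope.
Local Notation N := #|dom D|.
Local Notation word x := (val (enum_val x : dom D)).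

Section Progress.
Variables (A : qalg R C E n) (G : 'M[R]_N) (M : R).
Hypothesis GM : forall j, specnorm (hadamard G (Delta R D j)) <= M.
Local Notation state := 'cV[R[i]]_#|qbasis C n (qdim A)|.

Definition progress (Psi : 'I_N -> state) : R :=
  \sum_(x < N) \sum_(y < N) G x y * rip (Psi x) (Psi y).

(** The blocks of different query positions are orthogonal, so their squared lengths add up to that
    of the state and the sum over i costs no factor n. *)
Lemma block_progress_le (Phi : 'I_N -> state) :
  `|\sum_(i < n) \sum_(x < N) \sum_(y < N)
      hadamard G (Delta R D i) x y * bip i (Phi x) (Phi y)| <=
  M * \sum_(x < N) rip (Phi x) (Phi x).
Proof.
apply: le_trans (ler_norm_sum _ _ _) _.
under [X in _ <= _ * X]eq_bigr do rewrite rip_bip.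
rewrite exchange_big mulr_sumr /=; apply: ler_sum => i _.
apply: le_trans (family_bilin_le _ _ (fun x s => Phi x (enum_rank s) ord0)
                   (fun x s => Phi x (enum_rank s) ord0) ltr01) _.
rewrite invr1 !mul1r (_ : forall s S : R, s / 2 * (S + S) = s * S); last first.
  by move=> s S; field.
rewrite ler_wpM2r // sumr_ge0 // => x _; apply: sumr_ge0 => s _.
by rewrite addr_ge0 // -expr2 sqr_ge0.
Qed.

Lemma progress_query_le t (Psi : 'I_N -> state) :
  `|progress Psi - progress (fun x => query A (word x) t *m Psi x)| <=
  2 * M * \sum_(x < N) rip (Psi x) (Psi x).
Proof.
set Phi := fun x => _.
pose blocks F := \sum_(i < n) \sum_(x < N) \sum_(y < N)
      hadamard G (Delta R D i) x y * bip i (F x : state) (F y).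
(* Blocks with x_i = y_i do not change in the query and cancel; what remains is exactly what [Delta]
   keeps. *)
have -> : progress Psi - progress Phi = blocks Psi - blocks Phi.
  rewrite /progress /blocks -!sumrB.
  under [RHS]eq_bigr do rewrite -sumrB.
  rewrite exchange_big; apply: eq_bigr => x _ /=.
  under [RHS]eq_bigr do rewrite -sumrB.
  rewrite -sumrB exchange_big; apply: eq_bigr => y _ /=.
  rewrite -mulrBr !rip_bip -sumrB mulr_sumr; apply: eq_bigr => i _.
  rewrite !mxE -mulrBr -mulrA; congr (_ * _).
  have [xy|_] := eqVneq (word x i) (word y i); last by rewrite mul1r.
  by rewrite mul0r /Phi bip_query // subrr.
apply: le_trans (ler_normB _ _) _.
have PhiE : \sum_(x < N) rip (Psi x) (Psi x) = \sum_(x < N) rip (Phi x) (Phi x).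
  by apply: eq_bigr => x _; rewrite rip_query.
rewrite -mulrA mulrDl mul1r {2}PhiE; apply: lerD; exact: block_progress_le.
Qed.

Variable delta : 'I_N -> R.
Definition weighted t (x : 'I_N) : state := (delta x)%:C *: qstate A (word x) t.

Lemma rip_qstate (x : {ffun 'I_n -> C}) t : rip (qstate A x t) (qstate A x t) = 1.
Proof.
elim: t => [|t IH] /=; last by rewrite rip_unitary ?qunitP // rip_query.
rewrite rip_unitary ?qunitP //; apply: complexI.
by rewrite -sqnorm_rip qstart_norm.
Qed.

Lemma rip_weighted t x : rip (weighted t x) (weighted t x) = delta x ^+ 2.
Proof. by rewrite ripZ rip_qstate mulr1. Qed.

Lemma progress0 : progress (weighted 0) = bilin G delta delta.
Proof.
apply: eq_bigr => x _; apply: eq_bigr => y _.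
rewrite /weighted ripZ rip_unitary ?qunitP //.
have -> : rip (qstart A) (qstart A) = 1.
  by apply: complexI; rewrite -sqnorm_rip qstart_norm.
by rewrite mulr1 mulrA.
Qed.

Lemma progressS_le t :
  `|progress (weighted t) - progress (weighted t.+1)| <=
  2 * M * \sum_(x < N) delta x ^+ 2.
Proof.
have -> : progress (weighted t.+1) =
    progress (fun x => query A (word x) t *m weighted t x).
  apply: eq_bigr => x _; apply: eq_bigr => y _; congr (_ * _).
  by rewrite /weighted /= -!scalemxAr !ripZ rip_unitary ?qunitP.
apply: le_trans (progress_query_le _ _) _.
by under eq_bigr do rewrite rip_weighted.
Qed.

Lemma progress_le t :
  `|bilin G delta delta| <=
  `|progress (weighted t)| + 2 * t%:R * M * \sum_(x < N) delta x ^+ 2.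
Proof.
elim: t => [|t IH]; first by rewrite progress0 mulr0 !mul0r addr0.
have := progressS_le t.
have := ler_normD (progress (weighted t) - progress (weighted t.+1))
                  (progress (weighted t.+1)).
by rewrite subrK -natr1; lra.
Qed.

(** [h] divides the outcomes into two sides; an outcome is good for x if it lies on the side of f x.
    If x and y lie on different sides, each outcome is good for one and bad for the other, so only
    products of a good and a bad part occur, and the bad part has weight at most 1/3. *)
Lemma progress_final_le (f : dom D -> E) (h : E -> bool) T :
  computes f A T ->
  (forall x y : 'I_N, h (f (enum_val x)) = h (f (enum_val y)) -> G x y = 0) ->
  `|progress (weighted T)| <= 17 / 18 * specnorm G * \sum_(x < N) delta x ^+ 2.
Proof.
move=> Af Gh.
pose g (x : 'I_N) := h (f (enum_val x)).
pose good x e : state := ((h e == g x)%:R)%:C *: (qmeas A e *m weighted T x).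
pose bad x e : state := ((h e != g x)%:R)%:C *: (qmeas A e *m weighted T x).
pose good2 x := \sum_e rip (good x e) (good x e).
pose bad2 x := \sum_e rip (bad x e) (bad x e).
have goodbad x : good2 x + bad2 x = delta x ^+ 2.
  rewrite -(rip_weighted T) -(rip_kraus _ _ (qmeasP A)) -big_split /=.
  apply: eq_bigr => e _; rewrite !ripZ.
  by case: eqP => _ /=; rewrite !mul0r ?mulr1 ?mul1r ?addr0 ?add0r.
have bad2_le x : bad2 x <= 1 / 3 * delta x ^+ 2.
  suff : 2 / 3 * delta x ^+ 2 <= good2 x by have := goodbad x; lra.
  have := Af (enum_val x); rewrite /qprob sqnorm_rip.
  have -> : 2 / 3 = (2 / 3 : R)%:C by rewrite rmorphM fmorphV !rmorph_nat.
  rewrite lecR => p_ge.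
  rewrite /good2 (bigD1 (f (enum_val x))) //= ler_wpDr ?sumr_ge0 // => [e _|].
    exact: rip_ge0.
  rewrite !ripZ eqxx !mul1r /weighted -scalemxAr ripZ mulrC.
  by rewrite expr2 ler_wpM2l // -expr2 sqr_ge0.
have -> : progress (weighted T) =
  \sum_e ((\sum_(x < N) \sum_(y < N) G x y * rip (good x e) (bad y e)) +
          (\sum_(x < N) \sum_(y < N) G x y * rip (bad x e) (good y e))).
  rewrite /progress.
  under [RHS]eq_bigr do rewrite -big_split.
  rewrite [RHS]exchange_big; apply: eq_bigr => x _ /=.
  under [RHS]eq_bigr do rewrite -big_split.
  rewrite [RHS]exchange_big; apply: eq_bigr => y _ /=.
  under [RHS]eq_bigr do rewrite -mulrDr.
  rewrite -mulr_sumr.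
  have [/Gh -> |gxy] := eqVneq (g x) (g y); first by rewrite !mul0r.
  congr (_ * _); rewrite -(rip_kraus _ _ (qmeasP A)); apply: eq_bigr => e _.
  rewrite !ripZ; move: gxy.
  by case: (h e) (g x) (g y) => [] [] [] //= _;
    rewrite ?mul0r ?mul1r ?mulr1 ?add0r ?addr0 ?mul0r ?addr0 ?add0r.
apply: le_trans (ler_norm_sum _ _ _) _.
(* The weights 3/4 and 4/3 for the good and bad parts give at worst 3/4 * 2/3 + 4/3 * 1/3 = 17/18,
   which is below 1. *)
have th0 : 0 < 3 / 4 :> R by lra.
have th1 : 0 < (3 / 4)^-1 :> R by rewrite invr_gt0.
apply: le_trans (ler_sum _ (fun e _ => ler_normD _ _)) _.
apply: le_trans (ler_sum _ (fun e _ => lerD (family_rip_le _ _ _ th0)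
                                            (family_rip_le _ _ _ th1))) _.
rewrite invrK.
set s := specnorm G.
have -> : \sum_e (s / 2 * (3 / 4 * (\sum_x rip (good x e) (good x e)) +
      (3 / 4)^-1 * \sum_y rip (bad y e) (bad y e)) +
    s / 2 * ((3 / 4)^-1 * (\sum_x rip (bad x e) (bad x e)) +
      3 / 4 * \sum_y rip (good y e) (good y e))) =
   s * \sum_(x < N) (3 / 4 * good2 x + 4 / 3 * bad2 x).
  rewrite (eq_bigr (fun e => s * \sum_(x < N)
     (3 / 4 * rip (good x e) (good x e) + 4 / 3 * rip (bad x e) (bad x e)))).
    rewrite -mulr_sumr exchange_big; congr (_ * _); apply: eq_bigr => x _ /=.
    by rewrite big_split /= -!mulr_sumr.
  by move=> e _; rewrite big_split /= -!mulr_sumr; field.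
rewrite [X in _ <= X]mulrAC [X in _ <= X]mulrC ler_wpM2l ?specnorm_ge0 //.
rewrite mulr_sumr; apply: ler_sum => x _.
by have := goodbad x; have := bad2_le x; lra.
Qed.

End Progress.

Lemma specnorm_bipartite_le (f : dom D -> E) (h : E -> bool) (A : qalg R C E n) T
    (G : 'M[R]_N) (M : R) :
  0 <= M -> computes f A T -> G^T = G ->
  (forall x y : 'I_N, h (f (enum_val x)) = h (f (enum_val y)) -> G x y = 0) ->
  (forall j, specnorm (hadamard G (Delta R D j)) <= M) ->
  specnorm G <= 36 * T%:R * M.
Proof.
move=> M0 Af symG Gh GM.
(* The remaining 1/18 of the norm is at most 2 T M; hence 36 = 18 * 2. *)
suff : specnorm G <= 2 * T%:R * M + 17 / 18 * specnorm G by lra.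
apply: specnorm_le => // [|v].
  by rewrite addr_ge0 ?mulr_ge0 ?specnorm_ge0 //; lra.
have := progress_final_le v Af Gh; have := progress_le A GM v T.
rewrite mulrDl; lra.
Qed.

(** Flipping the value of h at e is an involution that exchanges the h separating e from e' with
    those that do not. *)
Lemma card_separating (e e' : E) : e != e' ->
  \sum_(h : {ffun E -> bool}) ((h e != h e')%:R : R) =
  #|{ffun E -> bool}|%:R / 2.
Proof.
move=> ee'.
pose flip (h : {ffun E -> bool}) := [ffun a => h a (+) (a == e)].
have flipK : involutive flip by move=> h; apply/ffunP => a; rewrite !ffunE addbK.
set S := \sum_h _; have SE : S = \sum_(h : {ffun E -> bool}) (h e == h e')%:R.
  rewrite /S (reindex flip) /=; last exact/onW_bij/inv_bij.
  apply: eq_bigr => h _; rewrite !ffunE eqxx [e' == e]eq_sym (negPf ee').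
  by case: (h e) (h e') => [] [].
suff -> : #|{ffun E -> bool}|%:R = S + S by field.
rewrite {1}SE /S -big_split /= -sum1_card natr_sum; apply: eq_bigr => h _.
by case: eqP; rewrite ?addr0 ?add0r.
Qed.

Lemma specnorm_adversary_le (f : dom D -> E) (A : qalg R C E n) T
    (G : 'M[R]_N) (M : R) :
  0 <= M -> computes f A T -> adversary_matrix f G ->
  (forall j, specnorm (hadamard G (Delta R D j)) <= M) ->
  specnorm G <= 72 * T%:R * M.
Proof.
move=> M0 Af [symG Gf] GM.
pose sep (h : {ffun E -> bool}) (x y : 'I_N) : R :=
  (h (f (enum_val x)) != h (f (enum_val y)))%:R.
pose Gs h : 'M[R]_N := \matrix_(x, y) (G x y * sep h x y).
have symE B : B^T = B -> forall x y, (B : 'M[R]_N) x y = B y x.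
  by move=> BT x y; rewrite -[in LHS]BT mxE.
have sepC h x y : sep h x y = sep h y x by rewrite /sep eq_sym.
have Gs_le h : specnorm (Gs h) <= 36 * T%:R * M.
  apply: (@specnorm_bipartite_le f h A) => // [|x y hxy|j].
  - by apply/matrixP => x y; rewrite !mxE (symE G) // sepC.
  - by rewrite mxE /sep hxy eqxx mulr0.
  apply: specnorm_le => // [|v].
    by apply/matrixP => x y; rewrite !mxE (symE G) // sepC eq_sym.
  (* With signs s_x for the two sides, the mask is (1 - s_x s_y) / 2. The masked form at v is half
     the difference of the unmasked forms at v and at s v, two vectors of equal length. *)
  pose sg (x : 'I_N) : R := if h (f (enum_val x)) then 1 else - 1.
  have sg2 x : sg x ^+ 2 = 1.
    by rewrite /sg; case: ifP; rewrite ?sqrrN expr1n.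
  have sepE x y : sep h x y = (1 - sg x * sg y) / 2.
    by rewrite /sep /sg; case: (h _) (h _) => [] [] /=; field.
  have -> : bilin (hadamard (Gs h) (Delta R D j)) v v =
     (bilin (hadamard G (Delta R D j)) v v -
      bilin (hadamard G (Delta R D j)) (fun x => sg x * v x) (fun x => sg x * v x)) / 2.
    rewrite /bilin -sumrB mulr_suml; apply: eq_bigr => x _.
    rewrite -sumrB mulr_suml; apply: eq_bigr => y _.
    by rewrite !mxE sepE; field.
  have := bilin_diag_le (hadamard G (Delta R D j)) v.
  have := bilin_diag_le (hadamard G (Delta R D j)) (fun x => sg x * v x).
  under eq_bigr do rewrite exprMn sg2 mul1r.
  set S := \sum_(i < N) _; have S0 : 0 <= S by exact: sumsqr_ge0.
  have := ler_wpM2r S0 (GM j).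
  by rewrite !ler_norml => ? /andP[? ?] /andP[? ?]; apply/andP; split; lra.
apply: specnorm_le => // [|v]; first by rewrite !mulr_ge0.
set S := \sum_(i < N) _.
set c := 36 * T%:R * M in Gs_le *.
have H0 : 0 < #|{ffun E -> bool}|%:R :> R.
  by rewrite ltr0n; apply/card_gt0P; exists [ffun=> true].
(* An entry at a pair with different values survives for exactly half of all h; hence 72 = 2 *
   36. *)
have GE : bilin G v v * (#|{ffun E -> bool}|%:R / 2) =
    \sum_(h : {ffun E -> bool}) bilin (Gs h) v v.
  rewrite /bilin mulr_suml exchange_big; apply: eq_bigr => x _ /=.
  rewrite mulr_suml exchange_big; apply: eq_bigr => y _ /=.
  have [/Gf G0|fxy] := eqVneq (f (enum_val x)) (f (enum_val y)).
    by rewrite G0 !mul0r big1 // => h _; rewrite mxE G0 !mul0r.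
  rewrite -(card_separating fxy) mulr_sumr; apply: eq_bigr => h _.
  by rewrite mxE /sep; ring.
have : `|\sum_h bilin (Gs h) v v| <= \sum_h `|bilin (Gs h) v v|.
  exact: ler_norm_sum.
rewrite -GE normrM [`|_ / 2|]ger0_norm; last by rewrite divr_ge0 // ltW.
have le_c h : `|bilin (Gs h) v v| <= c * S.
  by apply: le_trans (bilin_diag_le _ _) _; rewrite ler_wpM2r // sumsqr_ge0.
move=> /le_trans/(_ (ler_sum _ (fun h _ => le_c h))).
rewrite sumr_const -mulr_natl (_ : 72 * T%:R * M * S = 2 * (c * S)); last first.
  by rewrite /c; ring.
by move=> hle; rewrite -(ler_pM2r H0); lra.
Qed.

Lemma adversary_bound_le (f : dom D -> E) (A : qalg R C E n) T :
  computes f A T -> Adv R f <= 72 * T%:R.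
Proof.
move=> Af; rewrite /Adv; set S := (X in sup X).
have [->|S0] := eqVneq S set0; first by rewrite sup0 mulr_ge0.
apply: ge_sup; first exact/set0P.
move=> _ [G [Gadv _] <-]; set M := \big[Num.max/0]_(j < n) _.
have M0 : 0 <= M by apply: bigmax_ge_id.
(* The inverse of 0 is 0, so a zero denominator gives the ratio 0. *)
have [->|Mn0] := eqVneq M 0; first by rewrite invr0 mulr0 mulr_ge0.
rewrite ler_pdivrMr ?lt_def ?Mn0 //.
apply: specnorm_adversary_le Gadv _ => // j.
exact: (le_bigmax_cond _ (fun j => specnorm (hadamard G (Delta R D j)))).
Qed.

End LowerBound.

(** * Boundedness of the adversary ratio and lower bounds for it *)

Section AdvBounds.
Variables (R : realType) (C E : finType) (n : nat) (D : {set {ffun 'I_n -> C}}).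
Variable f : dom D -> E.
Local Notation N := #|dom D|.
Local Notation word x := (val (enum_val x : dom D)).

Lemma separating_index (x y : 'I_N) : f (enum_val x) != f (enum_val y) ->
  exists j, word x j != word y j.
Proof.
move=> fxy; apply/existsP; apply: contraNT fxy => /existsPn xy.
suff -> : enum_val x = enum_val y by [].
by apply/val_inj/ffunP => j; apply/eqP; have := xy j; rewrite negbK.
Qed.

Definition max_filtered_norm (G : 'M[R]_N) : R :=
  \big[Num.max/0]_(j < n) specnorm (hadamard G (Delta R D j)).

Lemma max_filtered_norm_ge0 G : 0 <= max_filtered_norm G.
Proof. exact: bigmax_ge_id. Qed.

(** A pair with different values of f is separated at some position j, and [Delta] keeps its entry
    there. *)
Lemma adversary_entry_le (G : 'M[R]_N) x y : adversary_matrix f G ->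
  `|G x y| <= max_filtered_norm G.
Proof.
move=> [_ Gf].
have [/Gf ->|/separating_index[j xyj]] :=
  eqVneq (f (enum_val x)) (f (enum_val y)).
  by rewrite normr0 max_filtered_norm_ge0.
apply: le_trans
  (le_bigmax_cond _ (fun j => specnorm (hadamard G (Delta R D j))) (erefl : predT j)).
by have := entry_le_specnorm (hadamard G (Delta R D j)) x y;
  rewrite !mxE xyj mulr1.
Qed.

(** A crude estimate that bounds the set of ratios in [Adv] and shows that a zero denominator forces
    a zero numerator. *)
Lemma specnorm_entry_le (G : 'M[R]_N) : adversary_matrix f G ->
  specnorm G <= N%:R * max_filtered_norm G.
Proof.
move=> Gadv; have M0 := max_filtered_norm_ge0 G; set M := max_filtered_norm G in M0 *.
apply: specnorm_le => [||v]; first by case: Gadv.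
  exact: mulr_ge0.
set S := \sum_(i < N) _.
have -> : N%:R * M * S =
    \sum_(x < N) \sum_(y < N) M * ((v x ^+ 2 + v y ^+ 2) / 2).
  have sumN (a : R) : \sum_(y < N) a = N%:R * a.
    by rewrite sumr_const card_ord mulr_natl.
  transitivity (\sum_(x < N) (N%:R * M * (v x ^+ 2 / 2) + M * S / 2)).
    by rewrite big_split /= sumN -mulr_sumr -mulr_suml -/S; field.
  apply: eq_bigr => x _; rewrite -mulr_sumr -mulr_suml big_split /= sumN -/S.
  by field.
apply: le_trans (ler_norm_sum _ _ _) _; apply: ler_sum => x _.
apply: le_trans (ler_norm_sum _ _ _) _; apply: ler_sum => y _.
rewrite -mulrA normrM ler_pM ?normr_ge0 ?adversary_entry_le //.
have := sqr_ge0 (v x - v y); have := sqr_ge0 (v x + v y).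
by rewrite ler_norml => ? ?; apply/andP; split; lra.
Qed.

Lemma Adv_ubound : has_ubound [set specnorm G / max_filtered_norm G
  | G in [set G | adversary_matrix f G /\ G != 0]]%classic.
Proof.
exists N%:R => _ [G [Gadv _] <-].
have [->|M0] := eqVneq (max_filtered_norm G) 0; first by rewrite invr0 mulr0.
by rewrite ler_pdivrMr ?specnorm_entry_le // lt_def M0 max_filtered_norm_ge0.
Qed.

(** A certificate in terms of quadratic forms: the filtered norms are at most 1 and v witnesses norm
    at least a. As a > 0, neither G nor the denominator vanishes. *)
Lemma Adv_ge (G : 'M[R]_N) (v : 'I_N -> R) (a : R) : adversary_matrix f G ->
  (forall j (u : 'I_N -> R),
     `|bilin (hadamard G (Delta R D j)) u u| <= \sum_(x < N) u x ^+ 2) ->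
  0 < a -> 0 < \sum_(x < N) v x ^+ 2 ->
  a * \sum_(x < N) v x ^+ 2 <= bilin G v v ->
  a <= Adv R f.
Proof.
move=> Gadv Gj a0 v0 av.
have a_le : a <= specnorm G.
  rewrite -(ler_pM2r v0) (le_trans av) // (le_trans (ler_norm _)) //.
  exact: bilin_diag_le.
have M1 : max_filtered_norm G <= 1.
  apply: bigmax_le => // j _; apply: specnorm_le => // [|u]; last by rewrite mul1r.
  case: Gadv => symG _; apply/matrixP => x y.
  by rewrite !mxE eq_sym -[in LHS]symG mxE.
have Mn0 : max_filtered_norm G != 0.
  apply/negP => /eqP M0; have := specnorm_entry_le Gadv.
  by rewrite M0 mulr0 leNgt (lt_le_trans a0 a_le).
have Mgt0 : 0 < max_filtered_norm G by rewrite lt_def Mn0 max_filtered_norm_ge0.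
apply: (@le_trans _ _ (specnorm G / max_filtered_norm G)).
  rewrite (le_trans a_le) // ler_pdivlMr // ler_piMr // specnorm_ge0 //.
apply: (ub_le_sup Adv_ubound); exists G => //; split=> //.
apply/negP => /eqP G0; have := specnorm_entry_le Gadv.
have -> : max_filtered_norm G = 0.
  apply/eqP; rewrite eq_le max_filtered_norm_ge0 andbT.
  apply: bigmax_le => // j _; apply: specnorm_le => //.
    by rewrite G0; apply/matrixP => x y; rewrite !mxE !mul0r.
  move=> u; rewrite mul0r G0 /bilin big1 ?normr0 // => x _.
  by rewrite big1 // => y _; rewrite !mxE !mul0r.
by rewrite mulr0 leNgt (lt_le_trans a0 a_le).
Qed.

(** The certificate is the matrix with entries 1 at (x, y) and (y, x), tested on the indicator of
    {x, y}. *)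
Lemma Adv_ge1 (x y : 'I_N) : f (enum_val x) != f (enum_val y) -> 1 <= Adv R f.
Proof.
move=> fxy; have xy : x != y by apply: contraNneq fxy => ->.
pose G : 'M[R]_N := delta_mx x y + delta_mx y x.
(* The premise says that B is supported on (x, y) and (y, x); it applies to G and to its filtered
   versions. *)
have deltaE (B : 'M[R]_N) (u : 'I_N -> R) :
    B = (\matrix_(i, j) (G i j * B i j)) ->
    bilin B u u = (B x y + B y x) * (u x * u y).
  move=> BE; have yx : y != x by rewrite eq_sym.
  rewrite /bilin (bigD1 x) //=.
  have Bz i j : ~~ ((i == x) && (j == y)) -> ~~ ((i == y) && (j == x)) -> B i j = 0.
    by move=> /negPf h1 /negPf h2; rewrite BE !mxE h1 h2 addr0 mul0r.
  rewrite (bigD1 y) //= [X in (_ + X) + _]big1 ?addr0; last first.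
    by move=> j jy; rewrite Bz ?mul0r // ?(negPf xy) ?(negPf jy) ?andbF.
  rewrite (bigD1 y) //= [X in _ + (_ + X)]big1 ?addr0; last first.
    move=> i /andP[ix iy]; rewrite big1 // => j _.
    by rewrite Bz ?mul0r // ?(negPf ix) ?(negPf iy).
  rewrite (bigD1 x) //= [X in _ + (_ + X)]big1 ?addr0; last first.
    by move=> j jx; rewrite Bz ?mul0r // ?(negPf yx) ?(negPf jx) ?andbF.
  by ring.
have Gxy : G x y = 1 /\ G y x = 1.
  by rewrite !mxE !eqxx (negPf xy) andbF /= addr0 add0r.
have GG : G = \matrix_(i, j) (G i j * G i j).
  apply/matrixP => i j; rewrite !mxE.
  case: (eqVneq i x) => [->|_]; rewrite ?andFb /=.
    by rewrite (negPf xy) /= addr0; case: (j == y); rewrite ?mulr1 ?mulr0.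
  by rewrite add0r; case: (_ && _); rewrite ?mulr1 ?mulr0.
apply: (@Adv_ge G (fun i => ((i == x) || (i == y))%:R)) => //.
- split=> [|i j fij]; first by rewrite /G linearD /= !trmx_delta addrC.
  rewrite !mxE.
  case: eqP => [ix|_] /=; last case: eqP => [iy|_] /=; last by rewrite addr0.
    rewrite ix (negPf xy) /= addr0; case: eqP => // jy.
    by rewrite -ix -jy fij eqxx in fxy.
  rewrite add0r; case: eqP => // jx.
  by rewrite -jx -iy fij eqxx in fxy.
- move=> j u; rewrite deltaE; last first.
    apply/matrixP => i k; rewrite [LHS]mxE [RHS]mxE [X in _ = _ * X]mxE mulrA.
    by congr (_ * _); rewrite [in LHS]GG mxE.
  have [-> ->] : hadamard G (Delta R D j) x y = (word x j != word y j)%:R /\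
                 hadamard G (Delta R D j) y x = (word x j != word y j)%:R.
    rewrite [_ x y]mxE [_ y x]mxE; case: Gxy => -> ->; rewrite !mul1r !mxE.
    by rewrite [_ == word x j]eq_sym.
  have : u x ^+ 2 + u y ^+ 2 <= \sum_(i < N) u i ^+ 2.
    rewrite (bigD1 x) //= (bigD1 y) 1?eq_sym //= addrA lerDl.
    exact: sumsqr_ge0.
  have := sqr_ge0 (u x - u y); have := sqr_ge0 (u x + u y).
  case: (word x j != word y j) => /= ? ? ?; rewrite ?addr0 ?mul0r ?normr0; last lra.
  by rewrite ler_norml; apply/andP; split; lra.
- by rewrite (bigD1 x) //= eqxx /= ltr_pwDl ?sumsqr_ge0 // expr1n.
- rewrite mul1r deltaE //; case: Gxy => -> ->.
  rewrite !eqxx orbT /= !mulr1 (bigD1 x) //= (bigD1 y) 1?eq_sym //= !eqxx orbT /=.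
  rewrite big1 ?addr0 ?expr1n // => i /andP[/negPf -> /negPf ->].
  by rewrite expr0n.
Qed.

End AdvBounds.

(** * Sublinear functionals and a finite form of Hahn-Banach *)

Section HahnBanach.
Variables (R : realType) (V : lmodType R).
Implicit Types (p q : V -> R).

Definition sublinear p :=
  (forall u v, p (u + v) <= p u + p v) /\ (forall c u, 0 < c -> p (c *: u) <= c * p u).

Lemma sublinear0 p : sublinear p -> p 0 = 0.
Proof.
move=> [pD pZ]; have := pD 0 0; have := pZ 2^-1 0; rewrite addr0 scaler0 => h.
have {}h := h ltac:(lra); lra.
Qed.

Lemma sublinearZ p : sublinear p -> forall c u, 0 <= c -> p (c *: u) = c * p u.
Proof.
move=> ps c u; rewrite le_eqVlt => /orP[/eqP <-|c0].
  by rewrite scale0r mul0r sublinear0.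
have [_ pZ] := ps; apply/eqP; rewrite eq_le pZ //=.
rewrite -ler_pdivlMl // -[X in p X <= _](scalerK (lt0r_neq0 c0) u).
by rewrite pZ ?invr_gt0.
Qed.

Lemma sublinearN p : sublinear p -> forall u, - p (- u) <= p u.
Proof.
move=> ps u; have := (ps.1 u (- u)); rewrite subrr sublinear0 //; lra.
Qed.

(** The classical step of the Hahn-Banach proof: a sublinear functional below p that is odd at z. *)
Definition along p (z u : V) : R :=
  inf [set p (u + t *: z) - t * p z | t in [set t : R | 0 <= t]]%classic.

Lemma along_lb p z u : sublinear p -> lbound
  [set p (u + t *: z) - t * p z | t in [set t : R | 0 <= t]]%classic (- p (- u)).
Proof.
move=> ps _ [t /= t0 <-]; have := ps.1 (u + t *: z) (- u).
by rewrite addrAC subrr add0r sublinearZ //; lra.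
Qed.

Lemma along_le p z u t : sublinear p -> 0 <= t ->
  along p z u <= p (u + t *: z) - t * p z.
Proof.
by move=> ps t0; apply: ge_inf; [exists (- p (- u)); exact: along_lb | exists t].
Qed.

Lemma le_along p z u (a : R) :
  (forall t, 0 <= t -> a <= p (u + t *: z) - t * p z) -> a <= along p z u.
Proof.
move=> ha; apply: lb_le_inf; first by exists (p (u + 0 *: z) - 0 * p z), 0 => /=.
by move=> _ [t /= t0 <-]; exact: ha.
Qed.

Lemma along_sublinear p z : sublinear p -> sublinear (along p z).
Proof.
move=> ps; split=> [u v|c u c0].
  rewrite -lerBlDr; apply: le_along => t t0.
  rewrite lerBlDr [X in _ <= X]addrC -lerBlDr; apply: le_along => s s0.
  have := along_le z (u + v) ps (addr_ge0 t0 s0).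
  have := ps.1 (u + t *: z) (v + s *: z).
  by rewrite addrACA -scalerDl; lra.
rewrite -ler_pdivrMl //; apply: le_along => t t0.
rewrite ler_pdivrMl //; have := along_le z (c *: u) ps (mulr_ge0 (ltW c0) t0).
by rewrite -scalerA -scalerDr (sublinearZ ps _ (ltW c0)) mulrBr mulrA.
Qed.

Lemma along_dominated p z u : sublinear p -> along p z u <= p u.
Proof.
by move=> ps; have := along_le z u ps (lexx 0); rewrite scale0r addr0 mul0r subr0.
Qed.

(** Taking t = 1 in the infimum gives a value at most - p z at - z, while the value at z is at most
    p z; sublinearity gives the converse inequality. *)
Lemma along_odd p z : sublinear p -> along p z (- z) = - along p z z.
Proof.
move=> ps; have as_ := along_sublinear z ps; apply/eqP; rewrite eq_le.
have := sublinearN as_ (- z); rewrite opprK => h; rewrite [X in _ && X]lerNl.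
have := along_le z (- z) ps ler01; rewrite scale1r addNr sublinear0 // mul1r => h1.
have h2 := along_dominated z z ps; have := sublinearN as_ z.
by move=> h3; apply/andP; split; lra.
Qed.

(** Where p is odd there is no room below it: q v >= - q (- v) >= - p (- v) = p v. Later steps
    therefore keep what earlier ones achieved. *)
Lemma odd_preserved p q v : sublinear q -> (forall u, q u <= p u) ->
  p (- v) = - p v -> q v = p v /\ q (- v) = - q v.
Proof.
move=> qs qp pv; have := qp v; have := qp (- v); have := sublinearN qs v.
rewrite pv => h1 h2 h3; split; lra.
Qed.

(** [along] is applied first at z, which keeps the value p z, and then at each vector of s. If s
    spans the space, q becomes linear. *)
Lemma sublinear_odd_on p (s : seq V) z : sublinear p ->
  exists q, [/\ sublinear q, forall u, q u <= p u, q z = p z &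
             forall v, v \in z :: s -> q (- v) = - q v].
Proof.
move=> ps; elim: s => [|v s [q [qs qp qz qodd]]].
  exists (along p z); split=> //.
  - exact: along_sublinear.
  - by move=> u; exact: along_dominated.
  - apply/eqP; rewrite eq_le along_dominated //=; apply: le_along => t t0.
    by rewrite -{2}[z]scale1r -scalerDl sublinearZ ?addr_ge0 //; lra.
  - by move=> v; rewrite mem_seq1 => /eqP ->; exact: along_odd.
have as_ := along_sublinear v qs.
have aq u := along_dominated v u qs.
exists (along q v); split=> // [u||u].
- exact: le_trans (aq u) (qp u).
- by rewrite (odd_preserved as_ aq (qodd z (mem_head _ _))).1.
rewrite !inE orbCA => /orP[/eqP ->|us]; first exact: along_odd.
by apply: (odd_preserved as_ aq (qodd u _)).2; rewrite inE.
Qed.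

End HahnBanach.

(** * Duality between the adversary bound and Gram vectors *)

Section Duality.
Variables (R : realType) (C E : finType) (n : nat) (D : {set {ffun 'I_n -> C}}).
Variable f : dom D -> E.
Local Notation N := #|dom D|.
Implicit Types M : 'M[R]_N.
Local Notation word x := (val (enum_val x : dom D)).
Local Notation val_of x := (f (enum_val (x : 'I_N))).

Definition gram k (w : 'M[R]_(N, k)) : 'M[R]_N := w *m w^T.

Definition differ (j : 'I_n) (x y : 'I_N) : R := (word x j != word y j)%:R.

(* The feasible set of the dual semidefinite program: the positive semidefinite
   matrices are given by their Gram vectors, the entries with equal values of f
   are free, and the diagonal carries the objective. *)
Definition dual_cone (M : 'M[R]_N) : Prop :=
  exists k (w p : 'I_n -> 'M[R]_(N, k)),
    (forall x y, val_of x != val_of y ->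
       M x y + M y x =
       2 * \sum_(j < n) differ j x y * (gram (w j) x y - gram (p j) x y)) /\
    (forall x, \sum_(j < n) (gram (w j) x x + gram (p j) x x) <= M x x).

Lemma gram_row_mx k l (w : 'M[R]_(N, k)) (w' : 'M[R]_(N, l)) :
  gram (row_mx w w') = gram w + gram w'.
Proof. by rewrite /gram tr_row_mx mul_row_col. Qed.

Lemma gramZ k (c : R) (w : 'M[R]_(N, k)) : gram (c *: w) = c ^+ 2 *: gram w.
Proof. by rewrite /gram linearZ /= -scalemxAl -scalemxAr scalerA. Qed.

Lemma dual_coneD M M' : dual_cone M -> dual_cone M' -> dual_cone (M + M').
Proof.
move=> [k [w [p [wp1 wp2]]]] [l [w' [p' [wp1' wp2']]]].
exists (k + l)%N, (fun j => row_mx (w j) (w' j)), (fun j => row_mx (p j) (p' j)).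
split=> [x y fxy|x].
  rewrite !mxE addrACA wp1 // wp1' // -mulrDr -big_split /=; congr (_ * _).
  by apply: eq_bigr => j _; rewrite !gram_row_mx !mxE; ring.
rewrite mxE; apply: le_trans (lerD (wp2 x) (wp2' x)); rewrite -big_split /=.
by apply: ler_sum => j _; rewrite !gram_row_mx !mxE le_eqVlt; apply/orP; left;
   apply/eqP; ring.
Qed.

Lemma dual_coneZ (c : R) M : 0 <= c -> dual_cone M -> dual_cone (c *: M).
Proof.
move=> c0 [k [w [p [wp1 wp2]]]].
exists k, (fun j => Num.sqrt c *: w j), (fun j => Num.sqrt c *: p j).
split=> [x y fxy|x].
  rewrite !mxE -mulrDr wp1 // mulrCA; congr (_ * _); rewrite mulr_sumr.
  by apply: eq_bigr => j _; rewrite !gramZ sqr_sqrtr // !mxE; ring.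
rewrite mxE; apply: le_trans (ler_wpM2l c0 (wp2 x)).
by rewrite mulr_sumr; apply: ler_sum => j _; rewrite !gramZ sqr_sqrtr // !mxE mulrDr.
Qed.

Lemma dual_cone_dominate M M' : dual_cone M ->
  (forall x y, val_of x != val_of y -> M' x y + M' y x = M x y + M y x) ->
  (forall x, M x x <= M' x x) -> dual_cone M'.
Proof.
move=> [k [w [p [wp1 wp2]]]] off diag; exists k, w, p; split=> [x y fxy|x].
  by rewrite off // wp1.
exact: le_trans (wp2 x) (diag x).
Qed.

Lemma dual_cone_free M :
  (forall x y, val_of x != val_of y -> M x y + M y x = 0) ->
  (forall x, 0 <= M x x) -> dual_cone M.
Proof.
move=> off diag; exists 0%N, (fun=> 0), (fun=> 0); split=> [x y fxy|x].
  by rewrite off // big1 ?mulr0 // => j _; rewrite subrr mulr0.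
by rewrite big1 // => j _; rewrite /gram mul0mx mxE addr0.
Qed.

(** A single Gram vector v at position j, on the w or the p side according to the sign. Testing a
    functional on these elements later bounds the filtered norms. *)
Lemma dual_cone_rank1 (j : 'I_n) (b : bool) (v : 'I_N -> R) :
  dual_cone (\matrix_(x, y)
    ((-1) ^+ b * differ j x y * v x * v y + (x == y)%:R * v x ^+ 2)).
Proof.
have gram_col x y : gram (\col_x v x) x y = v x * v y.
  by rewrite /gram !mxE big_ord1 !mxE.
have gram0 x y : gram (0 : 'M[R]_(N, 1)) x y = 0 by rewrite /gram mul0mx mxE.
exists 1%N, (fun i => if (i == j) && ~~ b then \col_x v x else 0),
            (fun i => if (i == j) && b then \col_x v x else 0).
split=> [x y fxy|x].
  have xy : x != y by apply: contraNneq fxy => ->.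
  rewrite !mxE [y == x]eq_sym (negPf xy) !mul0r !addr0.
  rewrite (bigD1 j) //= big1 ?addr0 => [|i /negPf ->]; last first.
    by rewrite gram0 subrr mulr0.
  have -> : differ j y x = differ j x y by rewrite /differ eq_sym.
  rewrite eqxx; case: b => /=; rewrite gram_col gram0 ?expr0 ?expr1; ring.
rewrite mxE /differ eqxx /= mulr0 !mul0r add0r eqxx mul1r.
rewrite (bigD1 j) //= big1 ?addr0 => [|i /negPf ->]; last first.
  by rewrite !gram0 addr0.
by rewrite eqxx; case: b => /=; rewrite gram_col gram0 ?addr0 ?add0r -expr2.
Qed.

Lemma sum_delta2 (x y : 'I_N) (F : 'I_N -> 'I_N -> R) :
  \sum_i \sum_j (delta_mx x y : 'M[R]_N) i j * F i j = F x y.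
Proof.
rewrite (bigD1 x) //= (bigD1 y) //= mxE !eqxx mul1r.
rewrite big1 ?addr0 => [|j jy]; last by rewrite mxE (negPf jy) andbF mul0r.
rewrite big1 ?addr0 // => i ix; rewrite big1 // => j _.
by rewrite mxE (negPf ix) mul0r.
Qed.

(** If f differs at x and y, a rank one element with v^2 = |c| / 2 on {x, y} yields c as the sum of
    the entries (x, y) and (y, x), at diagonal cost |c| / 2. Otherwise the entry is free or
    diagonal, where |c| + c >= 0. *)
Lemma dual_cone_delta (x y : 'I_N) (c : R) :
  dual_cone (`|c|%:M + c *: delta_mx x y).
Proof.
have normc0 : 0 <= `|c| + c by have := ler_norm (- c); rewrite normrN; lra.
have [fxy|fxy] := eqVneq (val_of x) (val_of y).
  apply: dual_cone_free => [i j fij|i]; rewrite !mxE; last first.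
    by rewrite eqxx mulr1n; case: (_ && _); rewrite ?mulr1 ?mulr0 ?addr0.
  have ij : i != j by apply: contraNneq fij => ->.
  rewrite [j == i]eq_sym (negPf ij) !mulr0n !add0r.
  have -> : (i == x) && (j == y) = false.
    by apply/negP => /andP[/eqP ix /eqP jy]; rewrite ix jy fxy eqxx in fij.
  have -> : (j == x) && (i == y) = false.
    by apply/negP => /andP[/eqP ix /eqP jy]; rewrite ix jy fxy eqxx in fij.
  by rewrite mulr0 addr0.
have xy : x != y by apply: contraNneq fxy => ->.
have [j xyj] := separating_index fxy.
have [v vM] : exists v : 'I_N -> R, forall i k, v i * v k =
    `|c| / 2 * ((i == x) || (i == y))%:R * ((k == x) || (k == y))%:R.
  exists (fun i => Num.sqrt (`|c| / 2) * ((i == x) || (i == y))%:R) => i k.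
  by rewrite mulrACA -expr2 sqr_sqrtr ?divr_ge0 // mulrA.
apply: (dual_cone_dominate (dual_cone_rank1 j (c < 0) v)) => [i k fik|i].
  have ik : i != k by apply: contraNneq fik => ->.
  rewrite !mxE [k == i]eq_sym (negPf ik) !mulr0n !mul0r !addr0 !add0r -!mulrA !vM.
  have -> : differ j k i = differ j i k by rewrite /differ eq_sym.
  have cE : (-1) ^+ (c < 0)%R * `|c| = c by rewrite mulr_sign_norm.
  transitivity (differ j i k * ((-1) ^+ (c < 0)%R * `|c|) *
     (((i == x) || (i == y)) && ((k == x) || (k == y)))%:R); last first.
    by rewrite -mulnb natrM; field.
  rewrite cE /differ.
  have yxj : word y j != word x j by rewrite eq_sym.
  case: (eqVneq i x) => [ix|_]; case: (eqVneq k x) => [kx|_];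
    case: (eqVneq i y) => [iy|_]; case: (eqVneq k y) => [ky|_] /=;
    rewrite ?mulr0 ?addr0 ?add0r ?mulr1 //; move: ik xy;
    rewrite ?ix ?kx ?iy ?ky ?eqxx ?xyj ?yxj ?mul1r //.
rewrite !mxE /differ !eqxx /= mulr0 !mul0r !add0r mul1r mulr1n expr2 vM.
have nc := normr_ge0 c.
case: (eqVneq i x) => [->|_] /=; first by rewrite (negPf xy) /= !mulr1 mulr0 addr0; lra.
by case: (i == y) => /=; rewrite ?mulr1 ?mulr0 addr0 ?mulr0; lra.
Qed.

(** The identity lies in the interior of the cone; this makes the infimum in [dual_value] one over a
    nonempty set. *)
Lemma dual_cone_shift (M : 'M[R]_N) : exists t, dual_cone (t%:M + M).
Proof.
rewrite (matrix_sum_delta M); pose P B := exists t : R, dual_cone (t%:M + B).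
apply: (big_ind P) => [|A B [t At] [s Bs]|x _].
- exists 0; apply: dual_cone_free => [x y _|x]; rewrite !mxE ?mul0rn ?addr0 //.
- exists (t + s); have := dual_coneD At Bs.
  by rewrite addrACA -raddfD.
apply: (big_ind P) => [|A B [t At] [s Bs]|y _].
- exists 0; apply: dual_cone_free => [x' y _|x']; rewrite !mxE ?mul0rn ?addr0 //.
- exists (t + s); have := dual_coneD At Bs.
  by rewrite addrACA -raddfD.
by exists `|M x y|; exact: dual_cone_delta.
Qed.

(** At [neq_matrix] this is the optimum of the dual program: the least bound on the total squared
    length of the Gram vectors at any x. *)
Definition dual_value (M : 'M[R]_N) : R := inf [set t | dual_cone (t%:M + M)]%classic.

Lemma dual_cone_diag_ge0 M x : dual_cone M -> 0 <= M x x.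
Proof.
move=> [k [w [p [_ wp]]]]; apply: le_trans (wp x); apply: sumr_ge0 => j _.
have g0 (z : 'M[R]_(N, k)) : 0 <= gram z x x.
  by rewrite mxE sumr_ge0 // => i _; rewrite mxE -expr2 sqr_ge0.
exact: addr_ge0.
Qed.

Hypothesis N0 : (0 < N)%N.
Let x0 : 'I_N := Ordinal N0.

Lemma dual_value_le M t : dual_cone (t%:M + M) -> dual_value M <= t.
Proof.
move=> Mt; apply: ge_inf => //; exists (- M x0 x0) => s /= /(@dual_cone_diag_ge0 _ x0).
by rewrite !mxE eqxx mulr1n; lra.
Qed.

Lemma le_dual_value M a : (forall t, dual_cone (t%:M + M) -> a <= t) -> a <= dual_value M.
Proof.
by move=> Ma; apply: lb_le_inf; [exact: dual_cone_shift | exact: Ma].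
Qed.

Lemma dual_cone_mono M (s t : R) : dual_cone (s%:M + M) -> s <= t -> dual_cone (t%:M + M).
Proof.
move=> Ms st; apply: (dual_cone_dominate Ms) => [x y fxy|x]; rewrite !mxE.
  have xy : x != y by apply: contraNneq fxy => ->.
  by rewrite [y == x]eq_sym (negPf xy) !mulr0n.
by rewrite eqxx !mulr1n lerD2r.
Qed.

Lemma dual_value_lt M t : dual_value M < t -> dual_cone (t%:M + M).
Proof.
move=> /(inf_lt (dual_cone_shift M)) [s /= Ms st].
exact: dual_cone_mono Ms (ltW st).
Qed.

Lemma dual_value_sublinear : sublinear dual_value.
Proof.
split=> [M M'|c M c0].
  rewrite -lerBlDr; apply: le_dual_value => t Mt.
  rewrite lerBlDr [X in _ <= X]addrC -lerBlDr; apply: le_dual_value => s Ms.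
  rewrite lerBlDr; apply: dual_value_le.
  by rewrite raddfD /= [s%:M + _]addrC addrACA; exact: dual_coneD.
rewrite -ler_pdivrMl //; apply: le_dual_value => t Mt.
rewrite ler_pdivrMl //; apply: dual_value_le.
by rewrite -scale_scalar_mx -scalerDr; apply: dual_coneZ => //; exact: ltW.
Qed.

Definition neq_matrix : 'M[R]_N := \matrix_(x, y) (val_of x != val_of y)%:R.

(** A linear q below [dual_value] that agrees with it at [neq_matrix] is given by a matrix g and is
    nonpositive on the cone. The off-diagonal part of g, rescaled by its diagonal, is an adversary
    matrix that certifies half the dual value. *)
Lemma dual_value_le_Adv : 0 < Adv R f -> dual_value neq_matrix <= 2 * Adv R f.
Proof.
move=> Adv0; have [a0|] := ltP 0 (dual_value neq_matrix); last lra.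
have [q [qs q_le qz q_odd]] := sublinear_odd_on
  [seq delta_mx xy.1 xy.2 | xy : 'I_N * 'I_N] neq_matrix dual_value_sublinear.
pose g x y := q (delta_mx x y).
(* q is odd on the matrix units, so subadditivity applied to M and to - M gives linearity. *)
have qE M : q M = \sum_x \sum_y M x y * g x y.
  have qN x y : q (- delta_mx x y) = - g x y.
    by apply: q_odd; rewrite inE; apply/orP; right; apply/mapP; exists (x, y);
      rewrite ?mem_enum.
  have qZ (c : R) x y : q (c *: delta_mx x y) = c * g x y.
    have [c0|c0] := leP 0 c; first by rewrite sublinearZ.
    have -> : c *: delta_mx x y = (- c) *: - (delta_mx x y : 'M[R]_N).
      by rewrite scaleNr scalerN opprK.
    by rewrite sublinearZ ?oppr_ge0 ?(ltW c0) // qN mulrNN.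
  have q_sum (I : finType) (F : I -> 'M[R]_N) : q (\sum_i F i) <= \sum_i q (F i).
    apply: (big_ind2 (fun u a => q u <= a)) => // [|u a v b ua vb].
      by rewrite sublinear0.
    exact: le_trans (qs.1 u v) (lerD ua vb).
  have le_sum M' : q M' <= \sum_x \sum_y M' x y * g x y.
    rewrite [X in q X](matrix_sum_delta M') (le_trans (q_sum _ _)) //.
    apply: ler_sum => x _; rewrite (le_trans (q_sum _ _)) //.
    by apply: ler_sum => y _; rewrite qZ.
  apply/eqP; rewrite eq_le le_sum /=.
  have := sublinearN qs M; have := le_sum (- M).
  have -> : \sum_x \sum_y (- M) x y * g x y = - \sum_x \sum_y M x y * g x y.
    rewrite -sumrN; apply: eq_bigr => x _; rewrite -sumrN; apply: eq_bigr => y _.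
    by rewrite mxE mulNr.
  lra.
have q_cone M : dual_cone M -> q M <= 0.
  by move=> Mc; apply: le_trans (q_le M) _; apply: dual_value_le; rewrite raddf0 add0r.
(* On lines contained in the cone q vanishes. This yields the symmetry of g and its zeros at pairs
   with equal values. *)
have q_eq0 M : dual_cone M -> dual_cone (- M) -> q M = 0.
  move=> /q_cone h1 /q_cone h2; apply/eqP; rewrite eq_le h1 /=.
  by have := sublinearN qs M; lra.
have g_sym x y : g x y = g y x.
  suff : q (delta_mx x y - delta_mx y x) = 0.
    have -> : q (delta_mx x y - delta_mx y x) =
        \sum_i \sum_j (delta_mx x y : 'M[R]_N) i j * g i j -
        \sum_i \sum_j (delta_mx y x : 'M[R]_N) i j * g i j.
      rewrite qE -sumrB; apply: eq_bigr => i _; rewrite -sumrB; apply: eq_bigr => j _.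
      by rewrite !mxE; ring.
    by rewrite !sum_delta2; lra.
  apply: q_eq0; apply: dual_cone_free => [i j _|i]; rewrite !mxE.
  - by rewrite [(j == x) && _]andbC [(j == y) && _]andbC; ring.
  - by rewrite andbC subrr.
  - by rewrite [(j == x) && _]andbC [(j == y) && _]andbC; ring.
  - by rewrite andbC subrr oppr0.
have g_free x y : x != y -> val_of x = val_of y -> g x y = 0.
  move=> xy fxy; apply: q_eq0; apply: dual_cone_free => [i j fij|i]; rewrite !mxE.
  - have -> : (i == x) && (j == y) = false.
      by apply/negP => /andP[/eqP ix /eqP jy]; rewrite ix jy fxy eqxx in fij.
    have -> : (j == x) && (i == y) = false.
      by apply/negP => /andP[/eqP ix /eqP jy]; rewrite ix jy fxy eqxx in fij.
    by rewrite addr0.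
  - by [].
  - have -> : (i == x) && (j == y) = false.
      by apply/negP => /andP[/eqP ix /eqP jy]; rewrite ix jy fxy eqxx in fij.
    have -> : (j == x) && (i == y) = false.
      by apply/negP => /andP[/eqP ix /eqP jy]; rewrite ix jy fxy eqxx in fij.
    by rewrite oppr0 addr0.
  - have -> : (i == x) && (i == y) = false.
      by apply/negP => /andP[/eqP ix /eqP iy]; rewrite -ix iy eqxx in xy.
    by rewrite oppr0.
pose mu x := - g x x.
have mu_ge0 x : 0 <= mu x.
  rewrite oppr_ge0; apply: q_cone; apply: dual_cone_free => [i j fij|i]; rewrite !mxE.
    have -> : (i == x) && (j == x) = false.
      by apply/negP => /andP[/eqP ix /eqP jy]; rewrite ix jy eqxx in fij.
    have -> : (j == x) && (i == x) = false.
      by apply/negP => /andP[/eqP ix /eqP jy]; rewrite ix jy eqxx in fij.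
    by rewrite addr0.
  by [].
have sum_mu : \sum_x mu x <= 1.
  have -> : \sum_x mu x = q (- 1%:M).
    rewrite qE; apply: eq_bigr => x _; rewrite (bigD1 x) //= !mxE eqxx mulr1n mulN1r.
    by rewrite big1 ?addr0 // => y; rewrite eq_sym !mxE => /negPf ->; rewrite oppr0 mul0r.
  apply: le_trans (q_le _) _; apply: dual_value_le; rewrite subrr.
  by apply: dual_cone_free => [i j _|i]; rewrite !mxE ?addr0.
(* The weights [mu] may vanish. Adding 1/N to each makes division possible and raises their sum from
   at most 1 to at most 2, the source of the factor 2. *)
pose r x := Num.sqrt (mu x + N%:R^-1).
have Nr0 : 0 < N%:R :> R by rewrite ltr0n.
have r2 x : r x ^+ 2 = mu x + N%:R^-1.
  by rewrite sqr_sqrtr // addr_ge0 // invr_ge0 ltW.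
have r_gt0 x : 0 < r x by rewrite sqrtr_gt0 ltr_wpDl // invr_gt0.
have sum_r2 : \sum_x r x ^+ 2 <= 2.
  under eq_bigr do rewrite r2.
  have NV : \sum_(x < N) N%:R^-1 = 1 :> R.
    by rewrite sumr_const card_ord -[LHS]mulr_natl divff ?gt_eqF.
  by rewrite big_split /= NV; lra.
pose G : 'M[R]_N := \matrix_(x, y) ((x != y)%:R * g x y / (r x * r y)).
have G_free x y : val_of x = val_of y -> G x y = 0.
  move=> fxy; rewrite mxE; have [|xy] := eqVneq x y; first by rewrite !mul0r.
  by rewrite g_free // mulr0 mul0r.
have sum_G : bilin G r r = dual_value neq_matrix.
  rewrite -qz qE; apply: eq_bigr => x _; apply: eq_bigr => y _.
  have [/[dup] /G_free -> fxy|fxy] := eqVneq (val_of x) (val_of y).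
    by rewrite !mxE fxy eqxx !mul0r.
  have xy : x != y by apply: contraNneq fxy => ->.
  rewrite !mxE xy fxy !mul1r.
  by field; rewrite !gt_eqF.
suff : dual_value neq_matrix / 2 <= Adv R f by lra.
have sr0 : 0 < \sum_x r x ^+ 2.
  by rewrite (bigD1 x0) //= ltr_pwDl ?sumsqr_ge0 // exprn_gt0.
apply: (@Adv_ge _ _ _ _ _ f G r) => //.
- split=> [|x y]; last exact: G_free.
  by apply/matrixP => x y; rewrite !mxE eq_sym g_sym [r y * _]mulrC.
- move=> j u.
  pose v x := u x / r x.
  have bE : bilin (hadamard G (Delta R D j)) u u =
      \sum_x \sum_y differ j x y * v x * v y * g x y.
    apply: eq_bigr => x _; apply: eq_bigr => y _; rewrite !mxE.
    have [<-|xy] := eqVneq x y; first by rewrite /differ eqxx !mul0r.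
    by rewrite /v /differ mul1r; field; rewrite !gt_eqF.
  (* q <= 0 at the rank one element of v = u / r; the two signs together bound the absolute
     value. *)
  have b_le (b : bool) : (-1) ^+ b * bilin (hadamard G (Delta R D j)) u u <=
      \sum_x mu x * v x ^+ 2.
    have := q_cone _ (dual_cone_rank1 j b v); rewrite qE.
    under eq_bigr do under eq_bigr do rewrite mxE mulrDl.
    under eq_bigr do rewrite big_split /=.
    rewrite big_split /=.
    have -> : \sum_x \sum_y (x == y)%:R * v x ^+ 2 * g x y =
       - \sum_x mu x * v x ^+ 2.
      rewrite -sumrN; apply: eq_bigr => x _; rewrite (bigD1 x) //= eqxx big1 ?addr0.
        by rewrite /mu mul1r; ring.
      by move=> y; rewrite eq_sym => /negPf ->; rewrite !mul0r.
    rewrite subr_le0 bE mulr_sumr.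
    apply: le_trans; rewrite le_eqVlt; apply/orP; left; apply/eqP.
    apply: eq_bigr => x _; rewrite mulr_sumr; apply: eq_bigr => y _.
    by rewrite !mulrA.
  have le_u : \sum_x mu x * v x ^+ 2 <= \sum_x u x ^+ 2.
    apply: ler_sum => x _; rewrite /v expr_div_n mulrA ler_pdivrMr ?exprn_gt0 //.
    rewrite mulrC ler_wpM2l ?sqr_ge0 // r2 lerDl invr_ge0 ltW //.
  have := b_le true; have := b_le false; rewrite expr0 expr1 mul1r mulN1r ler_norml.
  by move=> h1 h2; apply/andP; split; lra.
- by rewrite divr_gt0.
- rewrite sum_G; apply: le_trans (ler_wpM2l _ sum_r2) _; first by rewrite divr_ge0 // ltW.
  by rewrite divfK.
Qed.

End Duality.

(** * Orthogonal matrices that carry one family of vectors to another *)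

Section OrthogonalExtension.
Variables (R : realType) (m : nat).

Definition dotp (u v : 'cV[R]_m) : R := (u^T *m v) ord0 ord0.

Lemma dotpE u v : dotp u v = \sum_(i < m) u i ord0 * v i ord0.
Proof. by rewrite /dotp mxE; apply: eq_bigr => i _; rewrite mxE. Qed.

Lemma dotpC u v : dotp u v = dotp v u.
Proof. by rewrite !dotpE; apply: eq_bigr => i _; rewrite mulrC. Qed.

Lemma dotpBl u v z : dotp (u - v) z = dotp u z - dotp v z.
Proof. by rewrite !dotpE -sumrB; apply: eq_bigr => i _; rewrite !mxE mulrBl. Qed.

Lemma dotp_eq0 u : dotp u u = 0 -> u = 0.
Proof.
rewrite dotpE => /psumr_eq0P u0; apply/matrixP => i j; rewrite ord1 mxE; apply/eqP.
by rewrite -sqrf_eq0 expr2 u0 // => k _; rewrite -expr2 sqr_ge0.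
Qed.

Lemma dotp_orthogonal (U : 'M[R]_m) u v :
  U^T *m U = 1%:M -> dotp (U *m u) (U *m v) = dotp u v.
Proof. by move=> UU; rewrite /dotp trmx_mul -mulmxA (mulmxA U^T) UU mul1mx. Qed.

Definition householder (d : 'cV[R]_m) : 'M[R]_m :=
  1%:M - (2 / dotp d d) *: (d *m d^T).

Lemma householder_mul d v : householder d *m v = v - (2 / dotp d d * dotp d v) *: d.
Proof.
rewrite mulmxBl mul1mx -scalemxAl -mulmxA [d^T *m v]mx11_scalar mul_mx_scalar.
by rewrite scalerA.
Qed.

Lemma householder_orthogonal d : d != 0 ->
  (householder d)^T *m householder d = 1%:M.
Proof.
move=> d0; have s0 : dotp d d != 0 by apply: contraNneq d0 => /dotp_eq0 ->.
have -> : (householder d)^T = householder d.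
  by rewrite /householder linearB /= trmx1 linearZ /= trmx_mul trmxK.
rewrite {2}/householder mulmxBr mulmx1 -scalemxAr mulmxA householder_mul.
rewrite divfK //; have -> : d - 2 *: d = - d.
  by rewrite scaler_nat mulr2n opprD addrA subrr sub0r.
by rewrite mulNmx scalerN opprK subrK.
Qed.

(* Extend one column at a time: a reflection takes the next column to its image
   and fixes the columns already treated, which are orthogonal to its axis. *)
Lemma orthogonal_extension N (A B : 'I_N -> 'cV[R]_m) :
  (forall x y, dotp (A x) (A y) = dotp (B x) (B y)) ->
  exists U : 'M[R]_m, U^T *m U = 1%:M /\ forall x, U *m A x = B x.
Proof.
move=> AB.
suff : forall k, (k <= N)%N -> exists U : 'M[R]_m,
    U^T *m U = 1%:M /\ forall x : 'I_N, (x < k)%N -> U *m A x = B x.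
  move=> /(_ N (leqnn N))[U [UU UA]]; exists U; split=> // x; exact: UA.
elim=> [|k IH] kN; first by exists 1%:M; rewrite trmx1 mulmx1.
have [U [UU UA]] := IH (ltnW kN).
pose x0 : 'I_N := Ordinal kN.
pose a := U *m A x0; pose d := a - B x0.
have [d0|dn0] := eqVneq d 0.
  exists U; split=> // x; rewrite ltnS leq_eqVlt => /orP[/eqP xk|/UA //].
  have -> : x = x0 by apply/val_inj.
  by apply/eqP; rewrite -subr_eq0; apply/eqP.
exists (householder d *m U); split.
  by rewrite trmx_mul -mulmxA (mulmxA (householder d)^T) householder_orthogonal //
    mul1mx.
have dd : dotp d d != 0 by apply: contraNneq dn0 => /dotp_eq0 ->.
move=> x; rewrite ltnS leq_eqVlt -mulmxA householder_mul => /orP[/eqP xk|xk].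
  have -> : x = x0 by apply/val_inj.
  (* As a and [B x0] have equal length, the reflection along their difference d takes a to a - d =
     [B x0]. *)
  have da : dotp d d = 2 * dotp d a.
    rewrite {1}/d dotpBl (dotpC a) (dotpC (B x0)) /d !dotpBl -AB.
    by rewrite (dotpC (B x0) a) dotp_orthogonal //; ring.
  have -> : 2 / dotp d d * dotp d (U *m A x0) = 1.
    by rewrite -/a -[2 / _ * _]mulrAC -da divff.
  rewrite scale1r -/a.
  by rewrite /d opprB addrC subrK.
have d0 : dotp d (B x) = 0.
  by rewrite /d dotpBl -{1}(UA x xk) /a dotp_orthogonal // AB subrr.
by rewrite UA // d0 mulr0 scale0r subr0.
Qed.

End OrthogonalExtension.

(** * From families of states to algorithms *)

Section Simulation.
Variables (R : realType) (C E : finType) (n d N : nat).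
Variable word : 'I_N -> {ffun 'I_n -> C}.
Local Open Scope complex_scope.
Local Open Scope sesquilinear_scope.
Local Notation dim := #|qbasis C n d|.

Definition embed m k (v : 'M[R]_(m, k)) : 'M[R[i]]_(m, k) := map_mx (real_complex R) v.

Lemma rip_embed m (u v : 'cV[R]_m) : rip (embed u) (embed v) = dotp u v.
Proof.
by rewrite dotpE; apply: eq_bigr => i _; rewrite !mxE /cdot /= mulr0 addr0.
Qed.

Lemma embed_unitary m (U : 'M[R]_m) : U^T *m U = 1%:M -> embed U \is unitarymx.
Proof.
move=> UU; apply/unitarymxP.
have -> : (embed U)^t* = embed U^T.
  by apply/matrixP => i j; rewrite !mxE; exact: conjc_real.
by rewrite -map_mxM (mulmx1C UU) map_mx1.
Qed.

Definition shifted (t : nat) (y : {ffun 'I_n -> C}) (v : 'cV[R]_dim) : 'cV[R]_dim :=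
  \col_k v (enum_rank (oshift (query_shift (odd t)) y (enum_val k))) ord0.

(* An input-independent unitary takes one family of states to another as soon as
   the Gram matrices agree, so an algorithm can be given by its states. *)
Lemma algorithm_of_states (T : nat) (s : 'cV[R]_dim) (K : E -> 'M[R[i]]_dim)
    (phi : nat -> 'I_N -> 'cV[R]_dim) :
  dotp s s = 1 -> \sum_(e : E) (K e)^t* *m K e = 1%:M ->
  (forall t x y, (t < T)%N ->
     dotp (shifted t (word x) (phi t x)) (shifted t (word y) (phi t y)) =
     dotp (phi t.+1 x) (phi t.+1 y)) ->
  exists A : qalg R C E n, forall x, exists psi : 'cV[R[i]]_dim,
    (forall e, qprob A (word x) T e = sqnorm (K e *m psi)) /\
    rip (psi - embed (phi T x)) (psi - embed (phi T x)) =
    dotp (s - phi 0 x) (s - phi 0 x).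
Proof.
move=> s1 K1 gram_eq.
have : forall t, exists U : 'M[R]_dim, U^T *m U = 1%:M /\
    ((t < T)%N -> forall x, U *m shifted t (word x) (phi t x) = phi t.+1 x).
  move=> t; have [tT|_] := ltnP t T; last by exists 1%:M; rewrite trmx1 mulmx1.
  by have [U [UU UA]] := orthogonal_extension (fun x y => gram_eq t x y tT);
    exists U.
move=> /choice[U UP].
(* Unitary t + 1 follows query t, so the indices move by one and unitary 0 is the identity. *)
pose units t := if t is t'.+1 then embed (U t') else 1%:M.
have unitsP t : units t \is unitarymx.
  case: t => [|t]; last exact: embed_unitary (UP t).1.
  by apply/unitarymxP; rewrite mul1mx trmx1 map_mx1.
have start1 : sqnorm (embed s) = 1 by rewrite sqnorm_rip rip_embed s1.
pose A := @QAlg R C E n d (embed s) units odd K start1 unitsP K1.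
exists A => x; exists (qstate A (word x) T); split=> //.
(* True and prescribed states undergo the same isometry in every step, so their distance stays
   constant. *)
suff : forall t, (t <= T)%N ->
  rip (qstate A (word x) t - embed (phi t x)) (qstate A (word x) t - embed (phi t x)) =
  dotp (s - phi 0 x) (s - phi 0 x) by exact.
elim=> [_|t IH tT].
  by rewrite /= mul1mx -map_mxB rip_embed.
rewrite -IH ?(ltnW tT) //.
have -> : qstate A (word x) t.+1 - embed (phi t.+1 x) =
    units t.+1 *m (query A (word x) t *m (qstate A (word x) t - embed (phi t x))).
  rewrite 2!mulmxBr /=; congr (_ - _).
  rewrite -(UP t).2 // [LHS]map_mxM; congr (_ *m _).
  apply/matrixP => k l; have -> : l = ord0 by exact: ord1.
  rewrite -(enum_valK k).
  apply: etrans _ (esym (queryE (A := A) (word x) t (embed (phi t x)) (enum_val k))).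
  by rewrite enum_valK !mxE.
rewrite (rip_unitary _ _ (unitsP t.+1)); exact: (rip_query (A := A)).
Qed.

End Simulation.

(** * Layout of the registers *)

Section Layout.
Variables (R : realType) (C E K : finType) (n : nat) (j0 : 'I_n) (c0 : C).

(** The summands hold the amplitudes open to queries, the parked amplitudes, the start label and the
    answers. Parked amplitudes carry their own position and letter, since their query registers are
    in a fixed state. *)
Definition workspace : finType := (K + ('I_n * C * K) + (unit + E))%type.
Local Notation d := #|workspace|.
Local Notation dim := #|qbasis C n d|.

(* The amplitudes [alpha] are open to queries. All others sit at the query
   position [j0] in uniform superposition over the answer register, where the
   oracle acts trivially. *)
Definition layout (alpha beta : 'I_n -> C -> K -> R) (a : R) (b : E -> R) : 'cV[R]_dim :=
  \col_k let s : qbasis C n d := enum_val k in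
    let inert (z : R) := (s.1.1 == j0)%:R * (Num.sqrt #|C|%:R)^-1 * z in
    match (enum_val s.2 : workspace) with
    | inl (inl u) => alpha s.1.1 s.1.2 u
    | inl (inr u) => inert (beta u.1.1 u.1.2 u.2)
    | inr (inl _) => inert a
    | inr (inr e) => inert (b e)
    end.

Definition pairing (alpha alpha' : 'I_n -> C -> K -> R) : R :=
  \sum_(i < n) \sum_(c : C) \sum_(u : K) alpha i c u * alpha' i c u.

Lemma sum_inert (z z' : R) :
  \sum_(i < n) \sum_(c : C) ((i == j0)%:R * (Num.sqrt #|C|%:R)^-1 * z) *
     ((i == j0)%:R * (Num.sqrt #|C|%:R)^-1 * z') = z * z' :> R.
Proof.
rewrite (bigD1 j0) //= [X in _ + X]big1 ?addr0 => [|i /negPf ->]; last first.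
  by rewrite big1 // => c _; rewrite !mul0r.
have C0 : 0 < #|C|%:R :> R by rewrite ltr0n; apply/card_gt0P; exists c0.
rewrite sumr_const eqxx !mul1r mulrACA -expr2 exprVn sqr_sqrtr ?(ltW C0) //.
by rewrite -mulrnAl -[_^-1 *+ _]mulr_natl mulfV ?mul1r // gt_eqF.
Qed.

Lemma sum_workspace (F : 'I_n -> C -> workspace -> R) :
  \sum_(k < dim) (let s : qbasis C n d := enum_val k in
                  F s.1.1 s.1.2 (enum_val s.2)) =
  \sum_(i < n) \sum_(c : C)
    (\sum_u F i c (inl (inl u)) + \sum_u F i c (inl (inr u)) +
     (F i c (inr (inl tt)) + \sum_e F i c (inr (inr e)))).
Proof.
rewrite (reindex (@enum_rank (qbasis C n d))) /=; last first.
  exact: onW_bij (@enum_rank_bij _).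
under eq_bigr do rewrite enum_rankK.
transitivity (\sum_(i < n) \sum_(c : C) \sum_(w < d) F i c (enum_val w)).
  by rewrite pair_bigA pair_bigA.
apply: eq_bigr => i _; apply: eq_bigr => c _.
rewrite (reindex (@enum_rank workspace)) /=; last first.
  exact: onW_bij (@enum_rank_bij _).
under eq_bigr do rewrite enum_rankK.
rewrite !big_sumType /=; congr (_ + (_ + _)).
by rewrite (bigD1 tt) //= big1 ?addr0 // => -[].
Qed.

Lemma dotp_layout alpha beta a b alpha' beta' a' b' :
  dotp (layout alpha beta a b) (layout alpha' beta' a' b') =
  pairing alpha alpha' + pairing beta beta' + (a * a' + \sum_e b e * b' e).
Proof.
pose inert (i : 'I_n) (z : R) := (i == j0)%:R * (Num.sqrt #|C|%:R)^-1 * z.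
pose F i c (w : workspace) := match w with
  | inl (inl u) => alpha i c u * alpha' i c u
  | inl (inr u) => inert i (beta u.1.1 u.1.2 u.2) * inert i (beta' u.1.1 u.1.2 u.2)
  | inr (inl _) => inert i a * inert i a'
  | inr (inr e) => inert i (b e) * inert i (b' e)
  end.
rewrite dotpE (eq_bigr (fun k => let s : qbasis C n d := enum_val k in
   F s.1.1 s.1.2 (enum_val s.2))) ?sum_workspace /=; last first.
  by move=> k _; rewrite !mxE /F; case: (enum_val _.2) => [[|]|[|]].
have inert_sum (I : finType) (z z' : I -> R) :
    \sum_(i < n) \sum_(c : C) \sum_u inert i (z u) * inert i (z' u) =
    \sum_u z u * z' u.
  under eq_bigr do rewrite exchange_big /=.
  by rewrite exchange_big /=; apply: eq_bigr => u _; rewrite sum_inert.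
rewrite /pairing.
have -> : \sum_(i < n) \sum_(c : C) \sum_(u : K) beta i c u * beta' i c u =
   \sum_(u : 'I_n * C * K) beta u.1.1 u.1.2 u.2 * beta' u.1.1 u.1.2 u.2.
  by rewrite pair_bigA pair_bigA.
rewrite -(inert_sum _ (fun u => beta u.1.1 u.1.2 u.2) (fun u => beta' u.1.1 u.1.2 u.2)).
rewrite -inert_sum -(sum_inert a a') -!big_split /=; apply: eq_bigr => i _.
by rewrite -!big_split.
Qed.

Lemma layoutB alpha beta a b alpha' beta' a' b' :
  layout alpha beta a b - layout alpha' beta' a' b' =
  layout (fun i c u => alpha i c u - alpha' i c u)
         (fun i c u => beta i c u - beta' i c u) (a - a') (fun e => b e - b' e).
Proof.
by apply/matrixP => k l; rewrite !mxE /=;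
   case: (enum_val _.2) => [[|]|[|]] * //; rewrite mulrBr.
Qed.

(** Inert amplitudes do not depend on the answer register, the only one that a query shifts. *)
Lemma shifted_layout t y alpha beta a b :
  shifted t y (layout alpha beta a b) =
  layout (fun i c u => alpha i (query_shift (odd t) (y i) c) u) beta a b.
Proof. by apply/matrixP => k l; rewrite !mxE /= enum_rankK. Qed.

End Layout.

(** * The catalytic algorithm and its error *)

Section Algorithm.
Variables (R : realType) (C E : finType) (n : nat) (D : {set {ffun 'I_n -> C}}).
Variable f : dom D -> E.
Local Open Scope complex_scope.
Local Open Scope sesquilinear_scope.
Local Notation N := #|dom D|.
Local Notation word x := (val (enum_val (x : 'I_N) : dom D)).
Local Notation val_of x := (f (enum_val (x : 'I_N))).

Variables (j0 : 'I_n) (c0 : C) (e0 : E).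

Lemma zero_subproof : (0 < #|C|)%N.
Proof. by apply/card_gt0P; exists c0. Qed.

Definition zeroC : C := enum_val (Ordinal zero_subproof).

Lemma cshift_zeroC c : cshift c zeroC = c.
Proof.
apply: enum_rank_inj; rewrite /cshift enum_valK; apply: val_inj => /=.
by rewrite /zeroC enum_valK /= add0n modn_small.
Qed.

Variables (K : finType) (w p : 'I_N -> 'I_n -> K -> R) (T : nat).
Local Notation d := #|workspace C E K n|.
Local Notation dim := #|qbasis C n d|.

(** The vector T^(-1/2) sum_i |i, g_i> v_i; two of them overlap only at positions where their
    letters agree. *)
Definition indexed_by (g : 'I_n -> C) (v : 'I_n -> K -> R) (i : 'I_n) (c : C) (u : K) : R :=
  (Num.sqrt T%:R)^-1 * (c == g i)%:R * v i u.

Lemma pairing_indexed g g' v v' :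
  pairing (indexed_by g v) (indexed_by g' v') =
  T%:R^-1 * \sum_(i < n) (g i == g' i)%:R * \sum_u v i u * v' i u.
Proof.
rewrite /pairing mulr_sumr; apply: eq_bigr => i _.
rewrite exchange_big mulrA mulr_sumr; apply: eq_bigr => u _ /=.
rewrite (bigD1 (g i)) //= big1 ?addr0 => [|c /negPf cg]; last first.
  by rewrite /indexed_by cg !(mulr0, mul0r).
rewrite /indexed_by eqxx mulr1 mulrACA mulrA mulrAC mulrA mulrACA.
rewrite -expr2 exprVn sqr_sqrtr ?ler0n //; ring.
Qed.

(** The open part w has letter 0, to which a direct query adds x_i; p is parked with the letters of
    x. In [odd_state] the roles are swapped, and an inverse query returns p to letter 0. *)
Definition even_state (m : nat) (x : 'I_N) : 'cV[R]_dim :=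
  layout j0 (indexed_by (fun=> zeroC) (w x)) (indexed_by (word x) (p x))
    (Num.sqrt (1 - m%:R / T%:R)) (fun e => Num.sqrt (m%:R / T%:R) * (val_of x == e)%:R).

Definition odd_state (m : nat) (x : 'I_N) : 'cV[R]_dim :=
  layout j0 (indexed_by (word x) (p x)) (indexed_by (word x) (w x))
    (Num.sqrt (1 - m%:R / T%:R)) (fun e => Num.sqrt (m%:R / T%:R) * (val_of x == e)%:R).

(* The catalysts [w] and [p] are present throughout. Each pair of queries, one
   direct and one inverse, moves weight 1/T from the start to the answer. *)
Definition ideal_state (t : nat) (x : 'I_N) : 'cV[R]_dim :=
  if odd t then odd_state t./2 x else even_state t./2 x.

Hypothesis T0 : (0 < T)%N.
Hypothesis wpE : forall x y, \sum_(j < n) differ R j x y *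
  (\sum_u w x j u * w y j u - \sum_u p x j u * p y j u) = (val_of x != val_of y)%:R.
Hypothesis wp_le : forall x,
  30 * \sum_(j < n) (\sum_u w x j u ^+ 2 + \sum_u p x j u ^+ 2) <= T%:R.

Lemma weight_pairing m (x y : 'I_N) : (m <= T)%N ->
  Num.sqrt (1 - m%:R / T%:R) * Num.sqrt (1 - m%:R / T%:R) +
  \sum_e Num.sqrt (m%:R / T%:R) * (val_of x == e)%:R *
         (Num.sqrt (m%:R / T%:R) * (val_of y == e)%:R) =
  1 - m%:R / T%:R * (val_of x != val_of y)%:R :> R.
Proof.
move=> mT.
have Tgt0 : 0 < T%:R :> R by rewrite ltr0n.
have m0 : 0 <= m%:R / T%:R :> R by rewrite divr_ge0.
have m1 : m%:R / T%:R <= 1 :> R by rewrite ler_pdivrMr // mul1r ler_nat.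
rewrite -expr2 sqr_sqrtr ?subr_ge0 //.
rewrite (bigD1 (val_of x)) //= big1 ?addr0 => [|e]; last first.
  by rewrite eq_sym => /negPf ->; rewrite mulr0 mul0r.
rewrite eqxx mulr1 mulrA -expr2 sqr_sqrtr // [val_of y == _]eq_sym.
by case: eqP => _ /=; rewrite ?mulr0 ?mulr1 ?subr0 ?addr0 ?subrK.
Qed.

(** After a direct query the step merely exchanges open and parked parts. After an inverse query p
    has letter 0 and w has the letters of x, while the next state has them the other way round; by
    [wpE] the Gram matrices of the catalysts differ by 1/T at pairs with different values, which the
    weight moved to the answer compensates. *)
Lemma ideal_state_gram t x y : (t < T.*2)%N ->
  dotp (shifted t (word x) (ideal_state t x)) (shifted t (word y) (ideal_state t y)) =
  dotp (ideal_state t.+1 x) (ideal_state t.+1 y).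
Proof.
move=> tT; rewrite /ideal_state /= uphalf_half.
have m_lt : (t./2 < T)%N by rewrite ltn_half_double.
have shiftedE g v (z : 'I_N) s : (forall i c,
    (query_shift s (word z i) c == g i) = (c == (if s then zeroC else word z i))) ->
    (fun i c u => indexed_by g v i (query_shift s (word z i) c) u) =
    indexed_by (fun i => if s then zeroC else word z i) v.
  move=> gE; apply/funext => i; apply/funext => c; apply/funext => u.
  by rewrite /indexed_by gE.
have [todd|teven] := boolP (odd t); rewrite /= ?add0n ?add1n.
  rewrite !shifted_layout todd.
  have sE (z : 'I_N) i c : (query_shift true (word z i) c == word z i) = (c == zeroC).
    by rewrite /query_shift -[X in _ == X]cshift_zeroC (inj_eq (@cshift_inj _ _)).
  rewrite !(shiftedE _ _ _ true) // !dotp_layout // !weight_pairing ?(ltnW m_lt) //.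
  rewrite !pairing_indexed.
  have := wpE x y; rewrite /differ.
  set nf : R := (val_of x != val_of y)%:R => nfE.
  pose W i := \sum_u w x i u * w y i u; pose P i := \sum_u p x i u * p y i u.
  have -> : \sum_(i < n) (zeroC == zeroC)%:R * \sum_u p x i u * p y i u = \sum_i P i.
    by apply: eq_bigr => i _; rewrite eqxx mul1r.
  have -> : \sum_(i < n) (zeroC == zeroC)%:R * \sum_u w x i u * w y i u = \sum_i W i.
    by apply: eq_bigr => i _; rewrite eqxx mul1r.
  have eqE (F : 'I_n -> R) : \sum_(i < n) (word x i == word y i)%:R * F i =
     \sum_i F i - \sum_i (word x i != word y i)%:R * F i.
    rewrite -sumrB; apply: eq_bigr => i _.
    by case: eqP => _ /=; rewrite ?mul1r ?mul0r ?subr0 ?subrr.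
  rewrite !eqE -/W -/P.
  have WE : \sum_i (word x i != word y i)%:R * W i =
      nf + \sum_i (word x i != word y i)%:R * P i.
    rewrite -nfE -big_split /=; apply: eq_bigr => i _.
    by rewrite mulrBr subrK.
  rewrite WE -natr1; field.
  by rewrite pnatr_eq0 -lt0n.
rewrite !shifted_layout (negPf teven).
have sE (z : 'I_N) i c : (query_shift false (word z i) c == zeroC) = (c == word z i).
  rewrite /query_shift; apply/eqP/eqP => [cz|->].
    by rewrite -[LHS](f_invF (@cshift_inj _ (word z i))) cz cshift_zeroC.
  by apply: (@cshift_inj _ (word z i)); rewrite f_invF cshift_zeroC.
rewrite !(shiftedE _ _ _ false) // !dotp_layout //.
by rewrite [pairing _ _ + pairing _ _]addrC.
Qed.

Definition start_state : 'cV[R]_dim :=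
  layout j0 (fun _ _ _ => 0) (fun _ _ _ => 0) 1 (fun=> 0).

Lemma start_state_norm : dotp start_state start_state = 1.
Proof.
rewrite dotp_layout // /pairing.
have z : \sum_(i < n) \sum_(c : C) \sum_(u : K) (0 * 0 : R) = 0.
  by rewrite big1 // => i _; rewrite big1 // => c _; rewrite big1 // => u _; rewrite mul0r.
by rewrite !z !add0r mul1r big1 ?addr0 // => e _; rewrite mul0r.
Qed.

Lemma start_state_close x :
  dotp (start_state - ideal_state 0 x) (start_state - ideal_state 0 x) <= 1 / 30.
Proof.
rewrite /ideal_state /= /even_state /start_state layoutB dotp_layout //.
rewrite mul0r subr0 sqrtr1 sqrtr0 subrr mul0r add0r.
rewrite [X in _ + X]big1 ?addr0 => [|e _]; last by rewrite mul0r subr0 mul0r.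
have pN g v : pairing (fun i c u => 0 - indexed_by g v i c u)
                      (fun i c u => 0 - indexed_by g v i c u) =
    T%:R^-1 * \sum_(i < n) \sum_u v i u ^+ 2.
  transitivity (pairing (indexed_by g v) (indexed_by g v)).
    rewrite /pairing; apply: eq_bigr => i _; apply: eq_bigr => c _.
    by apply: eq_bigr => u _; rewrite !sub0r mulrNN.
  rewrite pairing_indexed; congr (_ * _); apply: eq_bigr => i _.
  by rewrite eqxx mul1r; apply: eq_bigr => u _; rewrite expr2.
rewrite !pN -mulrDr -big_split /=.
have Tgt0 : 0 < T%:R :> R by rewrite ltr0n.
rewrite mulrC ler_pdivrMr //; have := wp_le x; lra.
Qed.

(** Basis states without an answer count as [e0], so that the projections [readout] are complete. *)
Definition outcome (k : 'I_dim) : E :=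
  match (enum_val (enum_val k : qbasis C n d).2 : workspace C E K n) with
  | inr (inr e) => e | _ => e0 end.

Definition readout (e : E) : 'M[R[i]]_dim := diag_mx (\row_k (outcome k == e)%:R).

Lemma readout_complete : \sum_e (readout e)^t* *m readout e = 1%:M.
Proof.
apply/matrixP => k l; rewrite summxE.
rewrite (eq_bigr (fun e => (k == l)%:R * (outcome l == e)%:R)) => [|e _].
  rewrite -mulr_sumr (bigD1 (outcome l)) //= eqxx big1 ?addr0 ?mulr1 ?mxE //.
  by move=> e; rewrite eq_sym => /negPf ->.
have -> : (readout e)^t* = readout e.
  apply/matrixP => a b; rewrite !mxE rmorphMn /= conjC_nat [b == a]eq_sym.
  by case: (eqVneq a b) => [->|].
rewrite /readout mul_diag_mx !mxE; case: (eqVneq k l) => [->|_]; rewrite ?mul0r ?mulr0 //.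
by rewrite mulr1n mul1r -natrM mulnb andbb.
Qed.

Lemma rip_readout e (v : 'cV[R[i]]_dim) :
  rip (readout e *m v) (readout e *m v) =
  \sum_k (outcome k == e)%:R * cdot (v k ord0) (v k ord0).
Proof.
apply: eq_bigr => k _; rewrite /readout mul_diag_mx !mxE.
have -> : (outcome k == e)%:R = ((outcome k == e)%:R : R)%:C by rewrite rmorph_nat.
by rewrite cdotZ -natrM mulnb andbb.
Qed.

(** At the end the start weight is 0 and the answer part has length 1. The catalysts make the ideal
    state longer than a unit vector and can only add to the outcome. *)
Lemma ideal_state_readout x :
  1 <= rip (readout (val_of x) *m embed (ideal_state T.*2 x))
           (readout (val_of x) *m embed (ideal_state T.*2 x)).
Proof.
have TT : T%:R / T%:R = 1 :> R by rewrite divff // pnatr_eq0 -lt0n.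
rewrite rip_readout /ideal_state odd_double doubleK /even_state TT sqrtr1.
pose answer := layout j0 (fun _ _ _ => 0) (fun _ _ _ => 0) 0
  (fun e => 1 * (val_of x == e)%:R) : 'cV[R]_dim.
have ans1 : dotp answer answer = 1.
  rewrite dotp_layout // /pairing.
  have z : \sum_(i < n) \sum_(c : C) \sum_(u : K) (0 * 0 : R) = 0.
    by rewrite big1 // => i _; rewrite big1 // => c _; rewrite big1 // => u _; rewrite mul0r.
  rewrite !z !add0r mul0r add0r (bigD1 (val_of x)) //= eqxx !mulr1 big1 ?addr0 //.
  by move=> e; rewrite eq_sym => /negPf ->; rewrite mulr0 mul0r.
rewrite -[X in X <= _]ans1 dotpE; apply: ler_sum => k _.
rewrite !mxE /cdot /= [0 * 0]mulr0 addr0 /outcome.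
have sq_ge0 (b : bool) (z : R) : 0 <= b%:R * (z * z).
  by rewrite -expr2 mulr_ge0 ?sqr_ge0.
case: (enum_val (enum_val k).2) => [[u|u]|[u|e]] /=; rewrite ?mulr0 ?sq_ge0 //.
by rewrite [e == _]eq_sym; case: (_ == e); rewrite ?mul1r ?(mulr0, mul0r).
Qed.

Lemma algorithm_of_vectors : exists A : qalg R C E n, computes f A T.*2.
Proof.
have [A AP] := @algorithm_of_states R C E n d N (fun x => word x) T.*2 start_state
  readout ideal_state start_state_norm readout_complete ideal_state_gram.
exists A => a; rewrite -(enum_rankK a); set x := enum_rank a.
have [psi [-> psi_close]] := AP x.
have {}psi_close := psi_close.
rewrite sqnorm_rip.
have -> : 2 / 3 = (2 / 3 : R)%:C by rewrite rmorphM fmorphV !rmorph_nat.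
rewrite lecR.
have := ideal_state_readout x; have := start_state_close x; rewrite -psi_close.
move: (embed _) => v.
(* With squared error 1/30 this gives 1 <= 5/4 p + 1/6, that is p >= 2/3. Coordinatewise it is the
   square (5/2 s - 2 t)^2 >= 0. *)
suff : rip (readout (val_of x) *m v) (readout (val_of x) *m v) <=
  5 / 4 * rip (readout (val_of x) *m psi) (readout (val_of x) *m psi) +
  5 * rip (psi - v) (psi - v) by lra.
rewrite !rip_readout /rip !mulr_sumr -big_split /=; apply: ler_sum => k _.
rewrite !mxE; move: (psi k ord0) (v k ord0) => [r1 i1] [r2 i2]; rewrite /cdot /=.
have ineq (s t : R) : t * t <= 5 / 4 * (s * s) + 5 * ((s - t) * (s - t)).
  by have := sqr_ge0 (5 / 2 * s - 2 * t); rewrite expr2; lra.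
have := ineq r1 r2; have := ineq i1 i2.
have := sqr_ge0 (r1 - r2); have := sqr_ge0 (i1 - i2); rewrite !expr2.
by case: (_ == _); rewrite ?mul1r ?mul0r; lra.
Qed.

End Algorithm.

(** * Upper bound from dual solutions *)

Section Upper.
Variables (R : realType) (C E : finType) (n : nat) (D : {set {ffun 'I_n -> C}}).
Variable f : dom D -> E.
Local Open Scope complex_scope.
Local Open Scope sesquilinear_scope.
Local Notation N := #|dom D|.
Local Notation val_of x := (f (enum_val (x : 'I_N))).

Lemma Adv_const : (forall x y, f x = f y) -> Adv R f = 0.
Proof.
move=> f_const; rewrite /Adv; set S := (X in sup X).
suff -> : S = set0 by rewrite sup0.
apply/seteqP; split=> // t [G [[_ G0] /negP Gn0] _]; case: Gn0; apply/eqP.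
by apply/matrixP => x y; rewrite mxE G0.
Qed.

(* The dual program leaves the entries with equal values of f free. Multiplying
   the Gram matrices by J - F, a difference of two positive semidefinite matrices
   with unit diagonal, makes these entries 0 and doubles the objective. *)
Lemma vectors_of_dual_cone (t : R) : dual_cone f (t%:M + neq_matrix R f) ->
  exists (K : finType) (w p : 'I_N -> 'I_n -> K -> R),
    (forall x y, \sum_(j < n) differ R j x y *
      (\sum_u w x j u * w y j u - \sum_u p x j u * p y j u) =
      (val_of x != val_of y)%:R) /\
    (forall x, \sum_(j < n) (\sum_u w x j u ^+ 2 + \sum_u p x j u ^+ 2) <= 2 * t).
Proof.
move=> [k [w0 [p0 [off diag]]]].
(* The new w is w + p (x) |f x> and the new p is p + w (x) |f x>, as direct sums; the difference of
   their Gram matrices carries the factor 1 - [f x = f y]. *)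
pose tw (a b : 'I_n -> 'M[R]_(N, k)) (x : 'I_N) (j : 'I_n) (u : 'I_k + 'I_k * E) :=
  match u with inl u => a j x u | inr (u, e) => b j x u * (val_of x == e)%:R end.
have tw_gram a b x y j : \sum_u tw a b x j u * tw a b y j u =
    gram (a j) x y + gram (b j) x y * (val_of x == val_of y)%:R.
  rewrite big_sumType /= /gram !mxE; congr (_ + _).
    by apply: eq_bigr => u _; rewrite mxE.
  transitivity (\sum_(u < k) \sum_(e : E) b j x u * (val_of x == e)%:R *
      (b j y u * (val_of y == e)%:R)).
    by rewrite pair_bigA /=; apply: eq_bigr => -[u e].
  rewrite mulr_suml; apply: eq_bigr => u _ /=.
  rewrite (bigD1 (val_of x)) //= big1 ?addr0 => [|e]; last first.
    by rewrite eq_sym => /negPf ->; rewrite mulr0 mul0r.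
  by rewrite eqxx mulr1 mxE [val_of y == _]eq_sym mulrA.
exists ('I_k + 'I_k * E)%type, (tw w0 p0), (tw p0 w0); split=> [x y|x].
  under eq_bigr do rewrite !tw_gram.
  have [fxy|fxy] := eqVneq (val_of x) (val_of y).
    by rewrite big1 // => j _; rewrite !mulr1 [gram (p0 j) x y + _]addrC subrr mulr0.
  under eq_bigr do rewrite !mulr0 !addr0.
  have := off x y fxy; rewrite !mxE [val_of y == _]eq_sym fxy [y == x]eq_sym.
  have xy : x != y by apply: contraNneq fxy => ->.
  rewrite (negPf xy) !mulr0n !add0r.
  by move=> h; apply: (@mulfI _ 2); rewrite ?pnatr_eq0 // -h; ring.
have := diag x; rewrite !mxE eqxx mulr1n eqxx addr0.
have sq a b j : \sum_u tw a b x j u ^+ 2 = gram (a j) x x + gram (b j) x x.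
  under eq_bigr do rewrite expr2.
  by rewrite tw_gram eqxx mulr1.
move=> h; apply: le_trans (ler_wpM2l _ h) => //.
rewrite mulr_sumr; apply: ler_sum => j _; rewrite !sq.
lra.
Qed.

Lemma algorithm_of_Adv (a b : dom D) : f a != f b ->
  exists (A : qalg R C E n) (T : nat), computes f A T /\ T%:R <= 482 * Adv R f.
Proof.
move=> fab.
have N0 : (0 < N)%N by apply/card_gt0P; exists a.
have fab' : val_of (enum_rank a) != val_of (enum_rank b) by rewrite !enum_rankK.
have Adv1 := Adv_ge1 R fab'.
have [j0 _] := separating_index fab'.
have Adv0 : 0 < Adv R f by lra.
have := dual_value_le_Adv N0 Adv0 => dual_le.
(* The infimum need not be attained, so a value strictly above the bound 2 Adv is chosen. *)
have /dual_value_lt/vectors_of_dual_cone[K [w [p [wp_eq wp_le]]]] :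
  dual_value f (neq_matrix R f) < 4 * Adv R f by lra.
(* The vectors have squared length at most 2 * 4 Adv, and 240 = 30 * 8. The 2 T queries number at
   most 480 Adv + 2, and Adv >= 1 absorbs the 2. *)
pose T := (Num.truncn (240 * Adv R f)).+1.
have T_gt : 240 * Adv R f < T%:R by rewrite truncnS_gt.
have T_le : T%:R <= 240 * Adv R f + 1.
  by rewrite /T -natr1 lerD2r Num.Theory.truncn_le; lra.
have [A Af] : exists A : qalg R C E n, computes f A T.*2.
  apply: (@algorithm_of_vectors R C E n D f j0 (val a j0) (f a) K w p T) => // x.
  have := wp_le x; lra.
exists A, T.*2; split=> //.
rewrite -muln2 natrM; lra.
Qed.

Lemma algorithm_constant (j0 : 'I_n) (c0 : C) (e0 : E) : (forall x, f x = e0) ->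
  exists A : qalg R C E n, computes f A 0.
Proof.
move=> fe.
pose k0 : 'I_#|qbasis C n 1| := enum_rank ((j0, c0), ord0).
pose s : 'cV[R[i]]_#|qbasis C n 1| := delta_mx k0 ord0.
have s1 : sqnorm s = 1.
  rewrite /sqnorm (bigD1 k0) //= big1 => [|k /negPf kk0]; rewrite !mxE.
    by rewrite !eqxx normr1 expr1n addr0.
  by rewrite kk0 /= normr0 expr0n.
have unit1 (t : nat) : (1%:M : 'M[R[i]]_#|qbasis C n 1|) \is unitarymx.
  by apply/unitarymxP; rewrite mul1mx trmx1 map_mx1.
pose M (e : E) : 'M[R[i]]_#|qbasis C n 1| := (e == e0)%:R%:M.
have M1 : \sum_(e : E) (M e)^t* *m M e = 1%:M.
  rewrite (bigD1 e0) //= big1 ?addr0 => [|e /negPf ee0]; rewrite /M.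
    by rewrite eqxx mulmx1 trmx1 map_mx1.
  by rewrite ee0 raddf0 mulmx0.
exists (@QAlg R C E n 1 s (fun=> 1%:M) (fun=> true) M s1 unit1 M1) => x.
rewrite /qprob /= /M fe eqxx !mul1mx s1.
by rewrite ler_pdivrMr ?ltr0n // mul1r ler_nat.
Qed.

End Upper.

(** * Both bounds with explicit constants *)

Theorem corollary1p4 (R : realType) :
  exists c1 c2 : R, 0 < c1 /\ 0 < c2 /\
    forall (C E : finType) (n : nat) (D : {set {ffun 'I_n -> C}})
           (f : dom D -> E),
      ((c1 * Adv R f)%:E <= Q R f)%E /\
      (Q R f <= (c2 * Adv R f * ln (#|C|%:R : R) * ln (#|E|%:R : R))%:E)%E.
Proof.
have ln2_gt0 : 0 < ln 2 :> R by rewrite ln_gt0 // ltr1n.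
(* [k] keeps the numeral 482 from being unfolded by conversion. *)
have [k k_gt0 kE] : exists2 k : R, 0 < k & k = 482.
  by exists 482; rewrite ?ltr0n.
(* For nonconstant f both C and E have at least two elements, so each logarithm divided by ln 2 is
   at least 1 and the bound 482 Adv implies the claim. *)
exists (1 / 72), (k / ln 2 ^+ 2); split; first by lra.
split; first by rewrite divr_gt0 // exprn_gt0.
move=> C E n D f; rewrite /Q.
have [degenerate|] := ifP.
  suff -> : Adv R f = 0 by rewrite !mulr0 !mul0r.
  apply: Adv_const => x y.
  case/or3P: degenerate => [/eqP n0|/eqP C0|/eqP E0].
  - by congr f; apply/val_inj/ffunP => -[i lt_i_n]; exfalso; rewrite n0 in lt_i_n.
  - congr f; apply/val_inj/ffunP => i; exfalso.
    by have := card0_eq C0 (val x i); rewrite inE.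
  - by exfalso; have := card0_eq E0 (f x); rewrite inE.
move=> /negbT; rewrite !negb_or -!lt0n => /and3P[n0 C0 E0].
split.
  apply/ereal_infP => _ [T [A Af] <-]; rewrite lee_fin.
  by have := adversary_bound_le Af; lra.
have [[a [b fab]]|f_const] := pselect (exists a b, f a != f b).
  have [A [T [Af]]] := algorithm_of_Adv R fab; rewrite -kE => T_le.
  apply: le_trans (ereal_inf_lbound _) _; first by exists T => //; exists A.
  rewrite lee_fin (le_trans T_le) //.
  have Adv_ge0 : 0 <= Adv R f.
    have fab' : f (enum_val (enum_rank a)) != f (enum_val (enum_rank b)).
      by rewrite !enum_rankK.
    exact: le_trans ler01 (Adv_ge1 R fab').
  have ln_card (I : finType) (u v : I) : u != v -> ln 2 <= ln (#|I|%:R : R).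
    move=> uv; have I2 : (1 < #|I|)%N by apply/card_gt1P; exists u, v.
    by rewrite ler_ln ?posrE ?ltr0n // ?ler_nat // (ltnW I2).
  have lnE := ln_card _ _ _ fab.
  have lnC : ln 2 <= ln (#|C|%:R : R).
    have [|j] := @separating_index C E n D f (enum_rank a) (enum_rank b).
      by rewrite !enum_rankK.
    exact: ln_card.
  have -> : k / ln 2 ^+ 2 * Adv R f * ln #|C|%:R * ln #|E|%:R =
      k * Adv R f * ((ln #|C|%:R / ln 2) * (ln #|E|%:R / ln 2)).
    by field; rewrite gt_eqF.
  rewrite ler_peMr ?mulr_ge0 ?(ltW k_gt0) // -[1]mulr1 ler_pM // ler_pdivlMr ?mul1r //.
(* For constant f the right side is 0, so an algorithm without queries is required; the domain may
   be empty. *)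
have {}f_const x y : f x = f y.
  by apply/eqP; apply: contraT => fxy; exfalso; apply: f_const; exists x, y.
rewrite (Adv_const R f_const) mulr0 !mul0r.
have [e0 fe] : exists e0, forall x, f x = e0.
  have [[a]|D0] := pselect (inhabited (dom D)); first by exists (f a).
  case/card_gt0P: E0 => e0 _; exists e0 => x; exfalso; apply: D0; exact: inhabits x.
case/card_gt0P: C0 => c0 _.
have [A Af] := algorithm_constant R (Ordinal n0) c0 fe.
by apply: ereal_inf_lbound; exists 0%N => //; exists A.
Qed.
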